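(* Let $H\in(0,1)$ and let $B^H=\{B^H_t;\ t\in\mathbf{R}_+\}$ be fractional Brownian motion of parameter $H$. Almost surely, for every $t_0\in\mathbf{R}_+$, the $2$-microlocal frontier $s'\mapsto\boldsymbol{\sigma}_{t_0}(s')$ of $B^H$ at $t_0$ in the region $$D=\{(s',\sigma):\ -1<s'<0,\ 0<\sigma<1+s'\}$$ is equal to the line $\sigma=H+s'$; that is, the part of the graph of $\boldsymbol{\sigma}_{t_0}$ lying in $D$ coincides with the part of the line $\sigma=H+s'$ lying in $D$.
   Context: Fractional Brownian motion is the continuous (centered) Gaussian process $B^H$ with $E\big[(B^H_t-B^H_u)^2\big]=|t-u|^{2H}$ for all $t,u\in\mathbf{R}_+=[0,\infty)$. For a process $X=\{X_t;\ t\in\mathbf{R}_+\}$, the $2$-microlocal frontier at $t_0$ is the random function defined for $s'\in(-\infty,0)$ by $$\boldsymbol{\sigma}_{t_0}(s')=\sup\Big\{\sigma:\ \limsup_{\rho\to0}\ \sup_{t,u\in B(t_0,\rho),\,t\neq u}\frac{|X_t-X_u|}{|t-u|^{\sigma}\rho^{-s'}}<\infty\Big\},$$ where $B(t_0,\rho)$ is the ball of centre $t_0$ and radius $\rho$ in $\mathbf{R}_+$. *)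

(* Defs.v *)
From HB Require Import structures.
From mathcomp Require Import all_boot all_order all_algebra.
From mathcomp Require Import all_classical all_reals all_analysis.

Set Implicit Arguments.
Unset Strict Implicit.
Unset Printing Implicit Defensive.

Import Order.TTheory GRing.Theory Num.Theory.
Import numFieldNormedType.Exports.

Local Open Scope classical_set_scope.
Local Open Scope ring_scope.

(* Processes on [0, +oo[ are families X : R -> {RV P >-> R}; every condition
   below only involves times t >= 0, so the values of X at negative times are
   irrelevant. *)

Section processes.
Context {d : measure_display} {T : measurableType d} {R : realType}.
Variable P : probability T R.

(* Point masses are Gaussian laws (of zero variance). They need a separate
   clause because normal_prob m 0 is, by convention, the uniform law on
   [0, 1]. *)
Definition gaussian_law (mu : set R -> \bar R) : Prop :=
  (exists m : R, forall A : set R, measurable A -> mu A = \d_m A) \/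
  (exists m s : R, s != 0 /\
     forall A : set R, measurable A -> mu A = normal_prob m s A).

Definition gaussian_process (X : R -> {RV P >-> R}) : Prop :=
  forall (n : nat) (t a : 'I_n -> R), (forall i, 0 <= t i) ->
    gaussian_law (pushforward P (fun w => \sum_(i < n) a i * X (t i) w)).

Definition centered_process (X : R -> {RV P >-> R}) : Prop :=
  forall t : R, 0 <= t -> ('E_P[X t] = 0)%E.

Definition continuous_process (X : R -> {RV P >-> R}) : Prop :=
  {ae P, forall w, {within `[0, +oo[, continuous (fun t : R => X t w)}}.

Record fractional_brownian_motion (H : R) (X : R -> {RV P >-> R}) : Prop := {
  fbm_continuous : continuous_process X;
  fbm_gaussian : gaussian_process X;
  fbm_centered : centered_process X;
  fbm_increments : forall t u : R, 0 <= t -> 0 <= u ->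
    ('E_P[(fun w => (X t w - X u w) ^+ 2)%R])%E = (`|t - u| `^ (2 * H))%:E
}.

End processes.

Section frontier.
Context {R : realType}.

Definition ball_nonneg (t0 rho : R) : set R := ball t0 rho `&` `[0, +oo[.

Definition increment_ratio_sup (f : R -> R) (t0 s' sigma rho : R) : \bar R :=
  ereal_sup [set (`|f p.1 - f p.2| /
                  (`|p.1 - p.2| `^ sigma * rho `^ (- s')))%:E
            | p in [set p : R * R | [/\ ball_nonneg t0 rho p.1,
                                        ball_nonneg t0 rho p.2
                                      & p.1 != p.2]]].

(* The frontier of a path f on [0, +oo[. It is extended real: it is +oo when
   f is constant near t0. *)
Definition microlocal_frontier (f : R -> R) (t0 s' : R) : \bar R :=
  ereal_sup [set sigma%:E | sigma in
    [set sigma : R |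
      (limf_esup (increment_ratio_sup f t0 s' sigma) 0^'+ < +oo)%E]].

Definition frontier_graph (f : R -> R) (t0 : R) : set (R * R) :=
  [set p | p.1 < 0 /\ microlocal_frontier f t0 p.1 = p.2%:E].

Definition frontier_region : set (R * R) :=
  [set p | [/\ -1 < p.1, p.1 < 0, 0 < p.2 & p.2 < 1 + p.1]].

End frontier.

(* Main.v *)
(* Almost surely the frontier is [H + s'] at every [t0] and every [s' < 0].

   Lower bound: by Kolmogorov-Chentsov the path is locally Hoelder of every order
   [g < H], and [`|t - u| <= 2 rho] bounds [`|t - u| `^ g] by a multiple of
   [`|t - u| `^ (g + s') * rho `^ (- s')].

   Upper bound: a frontier above [H + s'] at some [t0] would make, at all small
   scales [h], the [q + 1] increments of step [h] starting at [i h + L j h],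
   [j <= q], all of size [O (h ^ (H + 1 / q))], where [i h] is the lattice point
   just below [t0]. For [L] large these increments, rescaled by [h ^ -H], have
   covariance matrix close to the identity, because the second differences of
   [x ^ (2 H)] tend to 0. Hence a given [i] is bad with probability
   [O ((h ^ (1 / q)) ^ (q + 1))], and summing over the [O (1 / h)] values of [i]
   leaves [O (h ^ (1 / q))], which tends to 0.

   The joint small-ball estimate only uses the laws of linear combinations: the
   expectation of [|sum_k exp (i k . X)| ^ 2], for [k] in a box of integer vectors,
   is a double sum of [E cos ((k - k') . X) = exp (- Var ((k - k') . X) / 2)]. *)

Require Import Defs.
From HB Require Import structures.
From mathcomp Require Import all_boot all_order all_algebra.
From mathcomp Require Import all_classical all_reals all_analysis measurable_realfun.
From mathcomp Require Import ring lra zify.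
Import Order.TTheory GRing.Theory Num.Theory.
Import numFieldNormedType.Exports.

Set Implicit Arguments.
Unset Strict Implicit.
Unset Printing Implicit Defensive.

Local Open Scope classical_set_scope.
Local Open Scope ring_scope.

(** * The normal distribution: Stein identity and characteristic function *)

Section whole_line.
Context {R : realType}.
Notation mu := (@lebesgue_measure R).

(** The fundamental theorem of calculus on [-n, n] gives F(n) - F(-n), which tends to 0; dominated
    convergence, with |f| as dominating function, identifies the limit with the integral over the
    line. *)
Lemma integral_derivative_vanishing (F f : R -> R) :
  (forall x, is_derive x (1 : R) F (f x)) -> continuous f ->
  mu.-integrable setT (EFin \o f) ->
  F n%:R @[n --> \oo] --> (0 : R) -> F (- n%:R) @[n --> \oo] --> (0 : R) ->
  (\int[mu]_x (f x)%:E = 0)%E.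
Proof.
move=> dF cf intf Fy FNy.
pose f_ n := (EFin \o f) \_ `[- (n%:R : R), n%:R].
have mf := measurable_int mu intf.
have mf_ n : measurable_fun setT (f_ n : _ -> \bar R).
  by apply/(measurable_restrictT _ _).1 => //; exact: measurable_funTS.
have cF : continuous F.
  by move=> x; apply/differentiable_continuous/derivable1_diffP; have [] := dF x.
have fle n x : (`|f_ n x| <= `|(EFin \o f) x|)%E.
  by rewrite /f_ patchE; case: ifP => _ //; rewrite abse0.
have fcvg x : f_ ^~ x @ \oo --> (EFin \o f) x.
  apply: cvg_near_cst; near=> n; rewrite /f_ patchE ifT//.
  rewrite inE/= in_itv/= -ler_norml.
  by near: n; exact: nbhs_infty_ger.
have lim1 : ((\int[mu]_x f_ n x) @[n --> \oo] --> \int[mu]_x (f x)%:E)%E.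
  have [] // := @dominated_convergence _ _ _ mu setT measurableT f_ (EFin \o f)
     (abse \o (EFin \o f)) mf_ mf.
  - by apply: aeW => x _; exact: fcvg.
  - exact: integrable_abse.
  - by apply: aeW => x n _; exact: fle.
have lim2 : (\int[mu]_x f_ n x)%E @[n --> \oo] --> 0%E.
  apply: (cvg_trans (G := (fun n => (F n%:R - F (- n%:R))%:E) @ \oo)).
    apply: near_eq_cvg; near=> n.
    rewrite /f_ -integral_mkcondr setTI (@continuous_FTC2 _ f F) ?EFinB//.
    - rewrite gtrN// ltr0n; near: n; exact: nbhs_infty_gt.
    - exact: continuous_subspaceT.
    - split; [by move=> x _; have [] := dF x| |].
      + exact/cvg_at_right_filter/cF.
      + exact/cvg_at_left_filter/cF.
    - by move=> x _; rewrite derive1E derive_val.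
  apply: cvg_EFin; first exact: nearW.
  rewrite -[X in _ --> X](subr0 0); exact: cvgB.
rewrite -(cvg_lim _ lim1)//; exact: cvg_lim.
Unshelve. all: by end_near. Qed.

End whole_line.

(** * Integration against the normal law through its density *)

Section normal_integral.
Context {R : realType}.
Notation mu := (@lebesgue_measure R).
Variables (m s : R).
Let nu := (normal_prob m s : probability (measurableTypeR R) R).

(** The change of variables below works with the abstract Radon-Nikodym derivative; it has the same
    integral as the explicit density over every measurable set. *)
Lemma normal_pdf_ae_eq :
  ae_eq mu setT (Radon_Nikodym_SigmaFinite.f nu mu)
    (fun x => (normal_pdf m s x)%:E).
Proof.
apply: integral_ae_eq => //.
- apply: Radon_Nikodym_SigmaFinite.f_integrable; exact: normal_prob_dominates.
- by apply/measurable_EFinP; exact: measurable_normal_pdf.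
- move=> E _ mE; rewrite -Radon_Nikodym_SigmaFinite.f_integral//.
  exact: normal_prob_dominates.
Qed.

Lemma ge0_integral_normal_prob (f : R -> \bar R) :
  measurable_fun [set: measurableTypeR R] f -> (forall x, 0 <= f x)%E ->
  (\int[nu]_x f x = \int[mu]_x (f x * (normal_pdf m s x)%:E))%E.
Proof.
move=> mf f0; rewrite -(@Radon_Nikodym_SigmaFinite.change_of_variables _ _ _ nu mu)//;
  last exact: normal_prob_dominates.
have mg := measurable_int _ (Radon_Nikodym_SigmaFinite.f_integrable
  (@normal_prob_dominates R m s)).
apply: ae_eq_integral => //.
- exact: emeasurable_funM.
- by apply: emeasurable_funM => //; apply/measurable_EFinP; exact: measurable_normal_pdf.
- exact/ae_eqe_mul2l/normal_pdf_ae_eq.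
Qed.

Lemma integrable_normal_prob (f : R -> R) :
  measurable_fun [set: measurableTypeR R] f ->
  nu.-integrable setT (EFin \o f) <->
  mu.-integrable setT (fun x => (f x * normal_pdf m s x)%:E).
Proof.
move=> mf; have mfp : measurable_fun [set: R] (fun x => (f x * normal_pdf m s x)%:E).
  by apply/measurable_EFinP/measurable_funM => //; exact: measurable_normal_pdf.
have E : (\int[nu]_x `|(EFin \o f) x| = \int[mu]_x `|(f x * normal_pdf m s x)%:E|)%E.
  rewrite ge0_integral_normal_prob//; last exact/measurableT_comp/measurable_EFinP.
  apply: eq_integral => x _.
  by rewrite EFinM abseM (@gee0_abs _ (normal_pdf m s x)%:E)// lee_fin normal_pdf_ge0.
split=> /integrableP[_ h]; apply/integrableP; split => //.
- by rewrite -E.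
- exact/measurable_EFinP.
- by rewrite E.
Qed.

Lemma integral_normal_prob (f : R -> R) :
  nu.-integrable setT (EFin \o f) ->
  (\int[nu]_x (f x)%:E = \int[mu]_x (f x * normal_pdf m s x)%:E)%E.
Proof.
move=> intf.
have mf : measurable_fun [set: measurableTypeR R] f.
  by apply/measurable_EFinP; case/integrableP: intf.
have mfe := measurable_int _ intf.
rewrite integralE [RHS]integralE !ge0_integral_normal_prob//; last 2 first.
  exact: measurable_funeneg.
  exact: measurable_funepos.
have p0 x : (0 <= (normal_pdf m s x)%:E)%E by rewrite lee_fin normal_pdf_ge0.
congr (_ - _)%E; apply: eq_integral => x _; rewrite ?funeposE ?funenegE.
  by rewrite maxe_pMl// mul0e EFinM.
by rewrite maxe_pMl// mul0e EFinM mulNe.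
Qed.

End normal_integral.

Section normal_density_formula.
Context {R : realType}.
Notation mu := (@lebesgue_measure R).
Variables (m s : R).
Hypothesis s0 : s != 0.

Lemma normal_pdf_peak_fun x :
  normal_pdf m s x = normal_peak s * expR (- (x - m) ^+ 2 / (s ^+ 2 *+ 2)).
Proof. by rewrite normal_pdfE. Qed.

End normal_density_formula.

(** * Exponential square moments and Stein's identity *)

Section normal_moments.
Context {R : realType}.
Notation mu := (@lebesgue_measure R).
Variables (m s : R).
Hypothesis s0 : s != 0.
Let nu := (normal_prob m s : probability (measurableTypeR R) R).
(** This weight cancels half of the Gaussian exponent, so [e] times the density is a multiple of the
    density with variance 2 s^2. Domination by a multiple of [e] is the common growth condition on
    test functions. *)
Let e (x : R) := expR ((x - m) ^+ 2 / (4 * s ^+ 2)).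

Lemma expR_mul_normal_pdf x :
  e x * normal_pdf m s x = Num.sqrt 2 * normal_pdf m (Num.sqrt 2 * s) x.
Proof.
have s2 : 0 < s ^+ 2 by rewrite exprn_even_gt0.
rewrite !normal_pdf_peak_fun ?mulf_neq0 ?sqrtr_eq0 -?ltNge//.
rewrite /e /normal_peak mulrCA -expRD [RHS]mulrA; congr (_ * expR _).
  have -> : (Num.sqrt 2 * s) ^+ 2 * pi *+ 2 = 2 * (s ^+ 2 * pi *+ 2).
    by rewrite exprMn sqr_sqrtr ?ler0n// -mulrA mulrnAr.
  rewrite (sqrtrM (s ^+ 2 * pi *+ 2)) ?ler0n// invfM mulrA divff ?mul1r//.
rewrite exprMn sqr_sqrtr ?ler0n//; field; exact: s0.
Qed.

Lemma continuous_exp_sqr : continuous e.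
Proof.
move=> x; apply: (@continuous_comp _ _ _ (fun x => (x - m) ^+ 2 / (4 * s ^+ 2)) expR);
  last exact: continuous_expR.
apply: continuousM; last exact: cvg_cst.
apply: (@continuous_comp _ _ _ (fun x => x - m) (fun x => x ^+ 2)).
  by apply: cvgB; [exact: cvg_id|exact: cvg_cst].
exact: exprn_continuous.
Qed.

Lemma integral_exp_sqr_normal : (\int[nu]_x (e x)%:E = (Num.sqrt 2)%:E)%E.
Proof.
have me : measurable_fun [set: measurableTypeR R] (fun x => (e x)%:E).
  by apply/measurable_EFinP; exact: continuous_measurable_fun continuous_exp_sqr.
rewrite ge0_integral_normal_prob//; last by move=> x; rewrite lee_fin expR_ge0.
under eq_integral do rewrite -EFinM expR_mul_normal_pdf EFinM.
rewrite integralZl//; last exact: integrable_normal_pdf.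
by rewrite integral_normal_pdf mule1.
Qed.

Lemma integrable_le_exp_sqr (f : R -> R) (C : R) :
  measurable_fun [set: measurableTypeR R] f -> (forall x, `|f x| <= C * e x) ->
  nu.-integrable setT (EFin \o f).
Proof.
move=> mf fC.
have me : measurable_fun [set: measurableTypeR R] (fun x => (e x)%:E).
  by apply/measurable_EFinP; exact: continuous_measurable_fun continuous_exp_sqr.
have inte : nu.-integrable setT (fun x => (C * e x)%:E).
  under eq_fun do rewrite EFinM.
  apply: integrableZl => //; apply/integrableP; split => //.
  under eq_integral do rewrite gee0_abs ?lee_fin ?expR_ge0//.
  by rewrite integral_exp_sqr_normal ltry.
apply: (le_integrable _ _ _ inte) => //; first exact/measurable_EFinP.
by move=> x _; rewrite /= lee_fin (le_trans (fC x))// ler_norm.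
Qed.

Lemma exp_sqr_ge1 x : 1 <= e x.
Proof.
by rewrite -expR0 ler_expR mulr_ge0 ?sqr_ge0// invr_ge0 mulr_ge0 ?sqr_ge0.
Qed.

Lemma sqr_le_exp_sqr x : (x - m) ^+ 2 <= 4 * s ^+ 2 * e x.
Proof.
have s2 : 0 < 4 * s ^+ 2 by rewrite mulr_gt0// exprn_even_gt0.
rewrite mulrC -ler_pdivrMr//; apply: le_trans (expR_ge1Dx _).
by rewrite lerDr.
Qed.

Lemma norm_le_exp_sqr x : `|x - m| <= (1 + 4 * s ^+ 2) * e x.
Proof.
have := sqr_le_exp_sqr x; have := exp_sqr_ge1 x; rewrite -real_normK ?num_real//.
have : 0 <= (`|x - m| - 1) ^+ 2 by exact: sqr_ge0.
by have := normr_ge0 (x - m); nra.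
Qed.

Lemma is_derive_normal_pdf x :
  is_derive x (1 : R) (normal_pdf m s) (- (x - m) / s ^+ 2 * normal_pdf m s x).
Proof.
rewrite (_ : normal_pdf m s = fun x => normal_peak s * expR (- (x - m) ^+ 2 / (s ^+ 2 *+ 2)));
  last by apply/funext => y; exact: normal_pdf_peak_fun.
have H : is_derive x (1 : R) (fun x => - (x - m) ^+ 2 / (s ^+ 2 *+ 2))
    (- (x - m) / s ^+ 2).
  apply: is_derive_eq; rewrite scaler0 add0r subr0 /GRing.scale/= !mulr1.
  by field.
apply: is_derive_eq.
by rewrite /GRing.scale/=; ring.
Qed.


(** Used with a = 1 and a = -1 for the boundary terms of Stein's identity. The product is at most a
    constant times the normal density of deviation sqrt(2) s, whose exponent at a n is at most a
    constant minus n. *)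
Lemma cvg_normal_tail (C a : R) (h : R -> R) : a != 0 ->
  (forall x, `|h x| <= C * e x) ->
  h (a * n%:R) * normal_pdf m s (a * n%:R) @[n --> \oo] --> (0 : R).
Proof.
move=> a0 hC; pose b := Num.sqrt 2 * s.
pose K := C * Num.sqrt 2 * normal_peak b.
pose v n := (- (a * n%:R - m) ^+ 2 / (b ^+ 2 *+ 2)).
have b0 : b != 0 by rewrite mulf_neq0// sqrtr_eq0 -ltNge.
have bb : 0 < (b ^+ 2 *+ 2)^-1.
  by rewrite invr_gt0 pmulrn_lgt0// exprn_even_gt0.
(* Completing the square in y = a n - m gives - k y^2 <= c - n for this [c]. *)
pose k := (b ^+ 2 *+ 2)^-1; pose c := (4 * k * a ^+ 2)^-1 + m / a.
have vle n : v n <= c - n%:R.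
  have -> : v n = c - n%:R - k * ((a * n%:R - m) - (2 * k * a)^-1) ^+ 2.
    rewrite /v /c -/k; field; rewrite a0 /= gt_eqF//.
  by rewrite gerBl mulr_ge0 ?sqr_ge0// ltW.
have E0 : K * expR c * expR (- n%:R) @[n --> \oo] --> (0 : R).
  rewrite -(mulr0 (K * expR c)); apply: cvgMl_tmp; exact: cvgn_expR.
apply/norm_cvg0P; apply: (squeeze_cvgr _ (cvg_cst 0) E0).
near=> n; rewrite normr_ge0/= normrM [X in _ * X]ger0_norm ?normal_pdf_ge0//.
apply: (le_trans (ler_wpM2r (normal_pdf_ge0 _ _ _) (hC _))).
have C0 : 0 <= C.
  have := le_trans (normr_ge0 _) (hC 0); rewrite pmulr_lge0//; exact: expR_gt0.
rewrite -(mulrA C) expR_mul_normal_pdf normal_pdf_peak_fun// /K !mulrA -!(mulrA (C * _ * _)).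
rewrite -expRD ler_wpM2l ?ler_expR ?vle//.
by rewrite !mulr_ge0 ?normal_peak_ge0.
Unshelve. all: by end_near. Qed.

(** Integration by parts: with p the density, ((x - m) h - s^2 h') p is the derivative of - s^2 h p,
    which vanishes at both infinities. *)
Lemma normal_stein (C : R) (h dh : R -> R) :
  (forall x, is_derive x (1 : R) h (dh x)) -> continuous dh ->
  (forall x, `|h x| <= C * e x) -> (forall x, `|dh x| <= C * e x) ->
  (forall x, `|(x - m) * h x| <= C * e x) ->
  (\int[nu]_x ((x - m) * h x)%:E = (s ^+ 2)%:E * \int[nu]_x (dh x)%:E)%E.
Proof.
move=> dH cdh hC dhC xhC.
have ch : continuous h.
  by move=> x; apply/differentiable_continuous/derivable1_diffP; have [] := dH x.
have cxh : continuous (fun x => (x - m) * h x).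
  move=> x; apply: cvgM; last exact: ch.
  by apply: cvgB; [exact: cvg_id|exact: cvg_cst].
have int1 : nu.-integrable setT (EFin \o (fun x => (x - m) * h x)).
  by apply: (@integrable_le_exp_sqr _ C) => //; exact: continuous_measurable_fun.
have int2 : nu.-integrable setT (EFin \o dh).
  by apply: (@integrable_le_exp_sqr _ C) => //; exact: continuous_measurable_fun.
have int3 : nu.-integrable setT (EFin \o (fun x => s ^+ 2 * dh x)).
  rewrite (_ : EFin \o _ = (fun x => (s ^+ 2)%:E * (EFin \o dh) x)%E).
    exact: integrableZl.
  by apply/funext => x /=; rewrite EFinM.
pose G x := (x - m) * h x - s ^+ 2 * dh x.
have intG : nu.-integrable setT (EFin \o G).
  rewrite (_ : EFin \o G = ((EFin \o (fun x => (x - m) * h x)%R) \-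
      (EFin \o (fun x => s ^+ 2 * dh x)%R))%E).
    exact: integrableB.
  by apply/funext => x /=; rewrite -EFinB.
have mG : measurable_fun [set: measurableTypeR R] G.
  by apply/measurable_EFinP; case/integrableP: intG.
have G0 : (\int[nu]_x (G x)%:E = 0)%E.
  rewrite integral_normal_prob//.
  apply: (@integral_derivative_vanishing R
    (fun x => - s ^+ 2 * h x * normal_pdf m s x) (fun x => G x * normal_pdf m s x)).
  - move=> x; have := is_derive_normal_pdf x => dp.
    apply: is_derive_eq; rewrite /GRing.scale/= /G; field; exact: s0.
  - move=> x; apply: cvgM; last exact: continuous_normal_pdf.
    apply: cvgB; first exact: cxh.
    by apply: cvgM; [exact: cvg_cst|exact: cdh].
  - exact/integrable_normal_prob.
  - rewrite -(mulr0 (- s ^+ 2)); under eq_fun do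
      rewrite -mulrA -[X in h X]mul1r -[X in normal_pdf _ _ X]mul1r.
    by apply: cvgMl_tmp; apply: (@cvg_normal_tail C) => //; exact: oner_neq0.
  - rewrite -(mulr0 (- s ^+ 2)); under eq_fun do rewrite -mulrA -mulN1r.
    by apply: cvgMl_tmp; apply: (@cvg_normal_tail C) => //; rewrite oppr_eq0 oner_neq0.
move: G0; rewrite /G; under eq_integral do rewrite EFinB.
rewrite integralB//; move/eqP; rewrite sube_eq; last 2 first.
- exact: integrable_fin_num int1.
- by rewrite fin_num_adde_defl// integrable_fin_num.
rewrite add0e => /eqP ->.
by rewrite -integralZl//.
Qed.

End normal_moments.

(** * Mean, variance and characteristic function of the normal law *)

Section normal_mean_variance_cf.
Context {R : realType}.
Notation mu := (@lebesgue_measure R).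
Variables (m s : R).
Hypothesis s0 : s != 0.
Let nu := (normal_prob m s : probability (measurableTypeR R) R).
Let e (x : R) := expR ((x - m) ^+ 2 / (4 * s ^+ 2)).

(** Stein's identity with test function 1. *)
Lemma normal_centered : (\int[nu]_x (x - m)%:E = 0)%E.
Proof.
have e1 := @exp_sqr_ge1 _ m s.
under eq_integral do rewrite -[X in X%:E]mulr1.
rewrite (@normal_stein _ m s s0 (1 + 4 * s ^+ 2) (cst 1) (cst 0)).
- by rewrite /= integral0 mule0.
- exact: cst_continuous.
- move=> x; rewrite normr1; have := e1 x; have := sqr_ge0 s; nra.
- move=> x; rewrite normr0; have := e1 x; have := sqr_ge0 s; nra.
- by move=> x; rewrite mulr1; exact: norm_le_exp_sqr.
Qed.

Lemma integrable_normal_sub : nu.-integrable setT (EFin \o (fun x => x - m)).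
Proof.
apply: (integrable_le_exp_sqr s0 _ (norm_le_exp_sqr m s0)).
exact: measurable_funB.
Qed.

Lemma integrable_normal_id : nu.-integrable setT (EFin \o id).
Proof.
rewrite (_ : EFin \o id = (EFin \o (fun x => x - m)%R) \+ (cst m%:E))%E.
  by apply: integrableD => //; [exact: integrable_normal_sub|exact: finite_measure_integrable_cst].
by apply/funext => x /=; rewrite -EFinD subrK.
Qed.

Lemma normal_mean : (\int[nu]_x x%:E = m%:E)%E.
Proof.
transitivity (\int[nu]_x ((x - m)%:E + cst m%:E x))%E.
  by apply: eq_integral => x _; rewrite -EFinD subrK.
rewrite integralD//; last 2 first.
- exact: integrable_normal_sub.
- exact: finite_measure_integrable_cst.
by rewrite normal_centered add0e integral_cst// [X in (_ * X)%E]probability_setT mule1.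
Qed.

(** Stein's identity with test function x - m. *)
Lemma normal_variance : (\int[nu]_x ((x - m) ^+ 2)%:E = (s ^+ 2)%:E)%E.
Proof.
have e1 := @exp_sqr_ge1 _ m s.
under eq_integral do rewrite expr2.
have dH (x : R) : is_derive x (1 : R) (fun x => x - m) (cst 1 x).
  by apply: is_derive_eq; rewrite subr0.
rewrite (@normal_stein _ m s s0 (1 + 4 * s ^+ 2) _ _ dH).
- rewrite (integral_cst _ measurableT 1%E).
  by rewrite [X in (_ * (_ * X))%E]probability_setT !mule1.
- exact: cst_continuous.
- exact: norm_le_exp_sqr.
- move=> x; rewrite normr1; have := e1 x; have := sqr_ge0 s; nra.
- move=> x; rewrite -expr2 ger0_norm ?sqr_ge0//.
  apply: le_trans (sqr_le_exp_sqr m s0 x) _.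
  by rewrite ler_wpM2r ?expR_ge0// lerDr.
Qed.

(** The characteristic function of the centred law, which is real by symmetry. *)
Let phi (a : R) := (\int[nu]_x cos (a * (x - m)))%R.

Lemma continuous_cos_lin a : continuous (fun x : R => cos (a * (x - m))).
Proof.
move=> x; apply: (@continuous_comp _ _ _ (fun x => a * (x - m)) (@cos R));
  last exact: continuous_cos.
by apply: cvgM; [exact: cvg_cst|apply: cvgB; [exact: cvg_id|exact: cvg_cst]].
Qed.

Lemma continuous_sin_lin a : continuous (fun x : R => sin (a * (x - m))).
Proof.
move=> x; apply: (@continuous_comp _ _ _ (fun x => a * (x - m)) (@sin R));
  last exact: continuous_sin.
by apply: cvgM; [exact: cvg_cst|apply: cvgB; [exact: cvg_id|exact: cvg_cst]].
Qed.

Lemma norm_cos_le1 (x : R) : `|cos x| <= 1.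
Proof. by rewrite ler_norml cos_geN1 cos_le1. Qed.

Lemma norm_sin_le1 (x : R) : `|sin x| <= 1.
Proof. by rewrite ler_norml sin_geN1 sin_le1. Qed.

Lemma integrable_normal_cos a :
  nu.-integrable setT (EFin \o (fun x => cos (a * (x - m)))).
Proof.
apply: (@integrable_le_exp_sqr _ m s s0 _ 1).
  exact: continuous_measurable_fun (@continuous_cos_lin a).
by move=> x; rewrite mul1r (le_trans (norm_cos_le1 _))// exp_sqr_ge1.
Qed.

(** Stein's identity with a sine as test function; it closes the differential equation for [phi]. *)
Lemma normal_xsin a :
  (\int[nu]_x ((x - m) * sin (a * (x - m)))%:E =
   (s ^+ 2 * a)%:E * \int[nu]_x (cos (a * (x - m)))%:E)%E.
Proof.
have e1 := @exp_sqr_ge1 _ m s.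
have dH (x : R) : is_derive x (1 : R) (fun x => sin (a * (x - m)))
    (a * cos (a * (x - m))).
  by apply: is_derive_eq; rewrite /GRing.scale/= subr0 mulr1 mulrC.
rewrite (@normal_stein _ m s s0 (1 + 4 * s ^+ 2 + `|a|) _ _ dH).
- rewrite [in RHS]EFinM -muleA; congr (_ * _)%E.
  under eq_integral do rewrite EFinM.
  by rewrite integralZl//; exact: integrable_normal_cos.
- by move=> x; apply: cvgM; [exact: cvg_cst|exact: continuous_cos_lin].
- move=> x; apply: le_trans (norm_sin_le1 _) _.
  have := e1 x; have := sqr_ge0 s; have := normr_ge0 a; nra.
- move=> x; rewrite normrM; have := norm_cos_le1 (a * (x - m)).
  have := e1 x; have := sqr_ge0 s; have := normr_ge0 a.
  have := normr_ge0 (cos (a * (x - m))); nra.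
- move=> x; rewrite normrM; apply: (@le_trans _ _ (`|x - m|)).
    by rewrite ler_piMr// norm_sin_le1.
  apply: le_trans (norm_le_exp_sqr m s0 x) _.
  by rewrite ler_wpM2r ?expR_ge0// lerDl.
Qed.

(** Differentiation under the integral sign, with |x - m| as dominating function, produces minus the
    integral evaluated by [normal_xsin]. *)
Lemma is_derive_normal_cf a :
  is_derive a (1 : R) phi (- (s ^+ 2 * a * phi a)).
Proof.
pose f (a x : R) := cos (a * (x - m)).
have d1 b x : is_derive b (1 : R) (f ^~ x) (- ((x - m) * sin (b * (x - m)))).
  by apply: is_derive_eq; rewrite /GRing.scale/=; ring.
have intf b : `]a - 1, a + 1[%classic b -> nu.-integrable setT (EFin \o f b).
  by move=> _; exact: integrable_normal_cos.
have Ia : `]a - 1, a + 1[%classic a by rewrite /= in_itv/=; lra.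
have df b x : `]a - 1, a + 1[%classic b -> [set: measurableTypeR R] x -> derivable (f ^~ x) b 1.
  by move=> _ _; have [] := d1 b x.
have dfE b x : partial1of2 f b x = - ((x - m) * sin (b * (x - m))).
  by rewrite partial1of2E derive_val.
have G_ub b x : `]a - 1, a + 1[%classic b -> [set: measurableTypeR R] x ->
    `|partial1of2 f b x| <= `|x - m|.
  by move=> _ _; rewrite dfE normrN normrM ler_piMr// norm_sin_le1.
have intG : nu.-integrable setT (EFin \o (fun x => `|x - m|)).
  exact: integrable_abse integrable_normal_sub.
have dphi := derivable_under_integral measurableT Ia intf df (fun _ => normr_ge0 _) intG G_ub.
split => //.
rewrite -derive1E
  (differentiation_under_integral measurableT Ia intf df (fun _ => normr_ge0 _) intG G_ub).
rewrite /Rintegral; under eq_integral do rewrite dfE.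
have intxs : nu.-integrable setT (EFin \o (fun x => (x - m) * sin (a * (x - m)))).
  apply: (@integrable_le_exp_sqr _ m s s0 _ (1 + 4 * s ^+ 2)).
    apply: measurable_funM; first exact: measurable_funB.
    exact: continuous_measurable_fun (@continuous_sin_lin a).
  move=> x; apply: le_trans (norm_le_exp_sqr m s0 x).
  by rewrite normrM ler_piMr// norm_sin_le1.
under eq_integral do rewrite EFinN.
rewrite integralN/=; last exact: integrable_add_def.
rewrite normal_xsin fineN fineM//.
exact: integrable_fin_num (integrable_normal_cos a).
Qed.

(** Since phi'(a) = - s^2 a phi(a), the function exp(a^2 s^2 / 2) phi(a) is constant, and it is 1 at
    a = 0. *)
Lemma normal_cf a :
  (\int[nu]_x (cos (a * (x - m)))%:E = (expR (- (a ^+ 2 * s ^+ 2) / 2))%:E)%E.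
Proof.
pose psi a := expR (a ^+ 2 * s ^+ 2 / 2) * phi a.
have dpsi b : is_derive b (1 : R) psi 0.
  have := is_derive_normal_cf b => dphi.
  apply: is_derive_eq; rewrite /GRing.scale/=; by field.
have psi0 : psi 0 = 1.
  rewrite /psi expr0n/= !mul0r expR0 mul1r /phi /Rintegral.
  under eq_integral do rewrite mul0r cos0.
  by rewrite integral_cst// [X in (_ * X)%E]probability_setT mul1e.
have := is_derive_0_is_cst a 0 dpsi; rewrite psi0 /psi => E.
rewrite -[LHS]fineK; last exact: integrable_fin_num (integrable_normal_cos a).
congr (_%:E); rewrite mulNr expRN.
apply: (@mulfI _ (expR (a ^+ 2 * s ^+ 2 / 2))); first by rewrite gt_eqF ?expR_gt0.
by rewrite mulfV ?gt_eqF ?expR_gt0.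
Qed.

End normal_mean_variance_cf.

(** * Gaussian variables *)

Section norm_level_sets.
Context {d : measure_display} {T : measurableType d} {R : realType}.
Variables (Y : T -> R) (e : R).
Hypothesis mY : measurable_fun setT Y.

Let mnY : measurable_fun setT (fun w => `|Y w|).
Proof. exact: measurableT_comp. Qed.

Lemma measurable_norm_le : measurable [set w | `|Y w| <= e].
Proof.
have -> : [set w | `|Y w| <= e] = (fun w => `|Y w|) @^-1` `]-oo, e].
  by apply/seteqP; split=> w /=; rewrite in_itv.
by rewrite -[X in measurable X]setTI; exact: mnY.
Qed.

Lemma measurable_norm_ge : measurable [set w | e <= `|Y w|].
Proof.
have -> : [set w | e <= `|Y w|] = (fun w => `|Y w|) @^-1` `[e, +oo[.
  by apply/seteqP; split=> w /=; rewrite in_itv/= andbT.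
by rewrite -[X in measurable X]setTI; exact: mnY.
Qed.

End norm_level_sets.

Section law_transfer.
Context {d : measure_display} {T : measurableType d} {R : realType}.
Variables (P : probability T R) (Y : {RV P >-> R}).
Variable nu : probability (measurableTypeR R) R.
Hypothesis lawY : forall A : set R, measurable A -> pushforward P Y A = nu A.

(* [Y] is retyped to [measurableTypeR R], the measurable structure of [nu]: it
   has the same measurable sets as [R] but another display. *)
Let Y' : T -> measurableTypeR R := Y.
Let mY' : measurable_fun setT Y'.
Proof. have h := @measurable_funPT _ _ _ _ Y. exact: h. Qed.
HB.instance Definition _ := isMeasurableFun.Build _ _ _ _ Y' mY'.

Lemma ge0_integral_law (f : R -> \bar R) :
  measurable_fun [set: measurableTypeR R] f -> (forall x, 0 <= f x)%E ->
  (\int[P]_w f (Y w) = \int[nu]_x f x)%E.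
Proof.
move=> mf f0; transitivity (\int[distribution P Y']_y f y)%E.
  exact/esym/ge0_integral_distribution.
by apply: eq_measure_integral => A mA _; exact: lawY.
Qed.

Lemma integrable_law (f : R -> R) : measurable_fun [set: measurableTypeR R] f ->
  nu.-integrable setT (EFin \o f) -> P.-integrable setT (EFin \o (f \o Y)).
Proof.
move=> mf /integrableP[_ intf]; apply/integrableP; split.
  exact/measurable_EFinP/measurableT_comp.
have -> : (\int[P]_w `|(EFin \o (f \o Y)) w| = \int[nu]_x `|(EFin \o f) x|)%E => //.
rewrite -ge0_integral_law//.
by apply/measurableT_comp => //; apply/measurable_EFinP.
Qed.

Lemma integral_law (f : R -> R) : measurable_fun [set: measurableTypeR R] f ->
  nu.-integrable setT (EFin \o f) ->
  (\int[P]_w (f (Y w))%:E = \int[nu]_x (f x)%:E)%E.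
Proof.
move=> mf intf.
transitivity (\int[distribution P Y']_y (EFin \o f) y)%E.
  apply/esym/integral_distribution; first exact/measurable_EFinP.
  exact: integrable_law.
by apply: eq_measure_integral => A mA _; exact: lawY.
Qed.

End law_transfer.

Section gaussian_variable.
Context {d : measure_display} {T : measurableType d} {R : realType}.
Variables (P : probability T R) (Y : {RV P >-> R}).
Hypothesis gaussY : gaussian_law (pushforward P Y).
Let delta (m : R) : probability (measurableTypeR R) R :=
  @dirac _ (measurableTypeR R) m R.
Let normal (m s : R) : probability (measurableTypeR R) R := normal_prob m s.

Lemma integrable_delta m (f : R -> R) :
  measurable_fun [set: measurableTypeR R] f ->
  (delta m).-integrable setT (EFin \o f).
Proof.
move=> mf; apply/integrableP; split; first by apply/measurable_EFinP.
rewrite integral_dirac//=; first by rewrite diracT mul1e ltry.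
by apply/measurable_EFinP; exact: measurableT_comp.
Qed.

Lemma integral_delta m (f : R -> R) :
  measurable_fun [set: measurableTypeR R] f ->
  (\int[delta m]_x (f x)%:E = (f m)%:E)%E.
Proof.
by move=> mf; rewrite integral_dirac//= ?diracT ?mul1e//; apply/measurable_EFinP.
Qed.

Lemma gaussian_integrable : P.-integrable setT (EFin \o Y).
Proof.
have -> : EFin \o Y = EFin \o (id \o Y) by [].
case: gaussY => [[m]|[m [s [s0]]]] lawY.
  by apply: (integrable_law (nu := delta m) lawY) => //; exact: integrable_delta.
apply: (integrable_law (nu := normal m s) lawY) => //.
exact: integrable_normal_id.
Qed.

Variable v : R.
Hypothesis EY : ('E_P[Y] = 0)%E.
Hypothesis EY2 : ('E_P[fun w => (Y w ^+ 2)%R] = v%:E)%E.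

(** The mean forces m = 0 in both clauses of [gaussian_law]; the second moment then identifies
    [v]. *)
Lemma centered_gaussian_law :
  (v = 0 /\ forall A : set R, measurable A -> pushforward P Y A = \d_(0 : R) A) \/
  (exists s : R, [/\ s != 0, v = s ^+ 2 &
    forall A : set R, measurable A -> pushforward P Y A = normal_prob 0 s A]).
Proof.
have msq : measurable_fun [set: measurableTypeR R] (fun x : R => (x ^+ 2)%:E).
  by apply/measurable_EFinP; exact: exprn_measurable.
case: gaussY => [[m]|[m [s [s0]]]] lawY; [left|right].
  pose nu := (delta m).
  have m0 : m = 0.
    move: EY; rewrite unlock (@integral_law _ _ _ P Y nu _ id)//.
      by rewrite integral_delta// => -[].
    exact: integrable_delta.
  split; last by rewrite -m0.
  move: EY2; rewrite unlock (@ge0_integral_law _ _ _ P Y nu _ (fun x => (x ^+ 2)%:E))//.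
    by rewrite (@integral_delta m (fun x => x ^+ 2))// m0 expr0n/= => -[].
  by move=> x; rewrite lee_fin sqr_ge0.
pose nu := (normal m s).
have m0 : m = 0.
  move: EY; rewrite unlock (@integral_law _ _ _ P Y nu _ id)//.
    by rewrite normal_mean// => -[].
  exact: integrable_normal_id.
exists s; split=> //; last by rewrite -m0.
move: EY2; rewrite unlock (@ge0_integral_law _ _ _ P Y nu _ (fun x => (x ^+ 2)%:E))//.
  have := normal_variance m s0.
  by rewrite m0; under eq_integral do rewrite subr0; rewrite /nu m0 => -> [].
by move=> x; rewrite lee_fin sqr_ge0.
Qed.

(** Point masses and normal laws give the same formula, so degenerate combinations require no
    separate treatment afterwards. *)
Lemma gaussian_expectation_cos :
  ('E_P[fun w => cos (Y w)] = (expR (- v / 2))%:E)%E.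
Proof.
have mc : measurable_fun [set: measurableTypeR R] (@cos R).
  exact: continuous_measurable_fun (@continuous_cos R).
rewrite unlock.
case: centered_gaussian_law => [[-> lawY]|[s [s0 -> lawY]]].
  rewrite (@integral_law _ _ _ P Y (delta 0) _ cos)//.
    by rewrite integral_delta// cos0 oppr0 mul0r expR0.
  exact: integrable_delta.
have intc := @integrable_normal_cos _ 0 s s0 1.
have cosE : (fun x : R => cos (1 * (x - 0))) = cos.
  by apply/funext => x; rewrite subr0 mul1r.
rewrite (@integral_law _ _ _ P Y (normal 0 s) _ cos)//.
  have := @normal_cf _ 0 s s0 1; rewrite expr1n mul1r => <-.
  by apply: eq_integral => x _; rewrite subr0 mul1r.
by move: intc; rewrite cosE.
Qed.

(** Markov's inequality for exp(Y^2 / (4 v)), whose mean is sqrt(2). *)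
Lemma gaussian_tail (y : R) : 0 < v -> 0 <= y ->
  (P [set w | (y <= `|Y w|)%R] <= (Num.sqrt 2 * expR (- (y ^+ 2 / (4 * v))))%:E)%E.
Proof.
move=> v0 y0.
case: centered_gaussian_law => [[v0' _]|[s [s0 vs lawY]]]; first by rewrite v0' ltxx in v0.
pose g (x : R) := expR (x ^+ 2 / (4 * v)).
have gE : g = (fun x => expR ((x - 0) ^+ 2 / (4 * s ^+ 2))).
  by apply/funext => x; rewrite /g vs subr0.
have mg : measurable_fun [set: measurableTypeR R] (fun x => (g x)%:E).
  apply/measurable_EFinP; rewrite gE.
  exact: continuous_measurable_fun (@continuous_exp_sqr _ 0 s).
have Eg : (\int[P]_w (g (Y w))%:E = (Num.sqrt 2)%:E)%E.
  rewrite (@ge0_integral_law _ _ _ P Y (normal 0 s) _ (fun x => (g x)%:E))//.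
    by rewrite gE integral_exp_sqr_normal.
  by move=> x; rewrite lee_fin expR_ge0.
set A := [set w | _].
have mA : measurable A by exact: measurable_norm_ge.
have : ((expR (y ^+ 2 / (4 * v)))%:E * P A <= (Num.sqrt 2)%:E)%E.
  have m1 : measurable_fun setT (fun w => (\1_A w)%:E : \bar R).
    by apply/measurable_EFinP; exact: measurable_indic.
  rewrite -Eg -(setIT A) -integral_indic// -ge0_integralZl//=.
  have mgR : measurable_fun (setT : set R) g by exact/measurable_EFinP.
  apply: ge0_le_integral => //=.
  - exact: emeasurable_funM.
  - by apply/measurable_EFinP; exact: measurableT_comp mgR _.
  move=> w _; rewrite -EFinM lee_fin indicE; case: (boolP (w \in A)) => [|_].
    rewrite inE /A/= => yY; rewrite mulr1 ler_expR ler_wpM2r//.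
      by rewrite invr_ge0 mulr_ge0// ltW.
    by rewrite -(real_normK (num_real (Y w))) ler_sqr ?nnegrE.
  by rewrite mulr0 expR_ge0.
rewrite -lee_pdivlMl ?expR_gt0// => /le_trans; apply.
by rewrite -EFinM lee_fin expRN mulrC.
Qed.

End gaussian_variable.

(** * Increments of fractional Brownian motion *)

Section gaussian_function.
Context {d : measure_display} {T : measurableType d} {R : realType}.
Variables (P : probability T R) (Y : T -> R) (v : R).
Hypothesis mY : measurable_fun setT Y.
Hypothesis gaussY : gaussian_law (pushforward P Y).
Hypothesis EY : (\int[P]_w (Y w)%:E = 0)%E.
Hypothesis EY2 : (\int[P]_w (Y w ^+ 2)%:E = v%:E)%E.
HB.instance Definition _ := isMeasurableFun.Build _ _ _ _ Y mY.

(** The Gaussian facts are restated for a function with a separate measurability proof, the form in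
    which combinations of increments arise below. *)
Lemma integral_cos_gaussian :
  (\int[P]_w (cos (Y w))%:E = (expR (- v / 2))%:E)%E.
Proof.
have := @gaussian_expectation_cos _ _ _ P Y gaussY v.
by rewrite unlock; apply.
Qed.

Lemma gaussian_tail_bound (y : R) : 0 < v -> 0 <= y ->
  (P [set w | (y <= `|Y w|)%R] <= (Num.sqrt 2 * expR (- (y ^+ 2 / (4 * v))))%:E)%E.
Proof.
move=> v0 y0; apply: (@gaussian_tail _ _ _ P Y) => //; by rewrite unlock.
Qed.

End gaussian_function.

Section fbm_increments.
Context {d : measure_display} {T : measurableType d} {R : realType}.
Variables (P : probability T R) (H : R) (B : R -> {RV P >-> R}).
Hypothesis fbmB : fractional_brownian_motion H B.

Lemma fbm_integrable t : 0 <= t -> P.-integrable setT (EFin \o B t).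
Proof.
move=> t0; apply: gaussian_integrable.
have gB := fbm_gaussian fbmB.
have := gB 1%N (fun=> t) (fun=> 1) (fun=> t0).
by rewrite (_ : (fun w => _) = B t)//; apply/funext => w; rewrite big_ord1 mul1r.
Qed.

Lemma fbm_combination_gaussian (s : seq (R * R)) :
  (forall x, x \in s -> 0 <= x.2) ->
  gaussian_law (pushforward P (fun w => \sum_(x <- s) x.1 * B x.2 w)).
Proof.
move=> s0; rewrite (_ : (fun w => _) =
    fun w => \sum_(i < size s) (nth (0, 0) s i).1 * B (nth (0, 0) s i).2 w); last first.
  by apply/funext => w; rewrite (big_nth (0, 0)) big_mkord.
by apply: (fbm_gaussian fbmB) => i; apply: s0; exact: mem_nth.
Qed.

Lemma fbm_combination_centered (s : seq (R * R)) :
  (forall x, x \in s -> 0 <= x.2) ->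
  P.-integrable setT (fun w => (\sum_(x <- s) x.1 * B x.2 w)%:E) /\
  (\int[P]_w (\sum_(x <- s) x.1 * B x.2 w)%:E = 0)%E.
Proof.
elim: s => [|x s IH] s0.
  split; under eq_fun do rewrite big_nil.
    exact: integrable0.
  by rewrite integral0.
have [ints Es] : P.-integrable setT (fun w => (\sum_(x <- s) x.1 * B x.2 w)%:E) /\
  (\int[P]_w (\sum_(x <- s) x.1 * B x.2 w)%:E = 0)%E.
  by apply: IH => y ys; apply: s0; rewrite inE ys orbT.
have x0 : 0 <= x.2 by apply: s0; rewrite inE eqxx.
have intx : P.-integrable setT (fun w => x.1%:E * (B x.2 w)%:E)%E.
  by apply: integrableZl => //; exact: fbm_integrable.
have -> : (fun w => (\sum_(x <- (x :: s)) x.1 * B x.2 w)%:E) =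
    ((fun w => x.1%:E * (B x.2 w)%:E) \+ (fun w => (\sum_(x <- s) x.1 * B x.2 w)%R%:E))%E.
  by apply/funext => w; rewrite big_cons EFinD EFinM.
split; first exact: integrableD.
rewrite integralD//= Es adde0 integralZl//; last exact: fbm_integrable.
by have := fbm_centered fbmB x0; rewrite unlock => ->; rewrite mule0.
Qed.

(** The covariance of B_t - B_u and B_a - B_b, by polarisation. *)
Definition fbm_cov (t u a b : R) : R :=
  2^-1 * (`|t - b| `^ (2 * H) + `|u - a| `^ (2 * H)
          - `|t - a| `^ (2 * H) - `|u - b| `^ (2 * H)).

Variables (k : nat) (z t u : 'I_k -> R).
Hypotheses (t0 : forall j, 0 <= t j) (u0 : forall j, 0 <= u j).
Let W w := \sum_(j < k) z j * (B (t j) w - B (u j) w).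

Lemma measurable_increments : measurable_fun setT W.
Proof.
apply: measurable_sum => j; apply: measurable_funM => //.
exact: measurable_funB.
Qed.

(** [gaussian_process] concerns combinations of values, so each increment is split into two terms
    with opposite coefficients. *)
Let s := [seq (z j, t j) | j <- index_enum 'I_k] ++ [seq (- z j, u j) | j <- index_enum 'I_k].

Let s0 x : x \in s -> 0 <= x.2.
Proof. by rewrite mem_cat => /orP[] /mapP[j _ ->]; [exact: t0|exact: u0]. Qed.

Let WE : W = fun w => \sum_(x <- s) x.1 * B x.2 w.
Proof.
apply/funext => w; rewrite big_cat/= !big_map -big_split/=.
by apply: eq_bigr => j _; rewrite mulrBr mulNr.
Qed.

Lemma increments_gaussian : gaussian_law (pushforward P W).
Proof. by rewrite WE; exact: fbm_combination_gaussian. Qed.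

Lemma increments_centered : (\int[P]_w (W w)%:E = 0)%E.
Proof. by rewrite WE; have [] := fbm_combination_centered s0. Qed.

Lemma fbm_sqr_increment a b : 0 <= a -> 0 <= b ->
  (\int[P]_w ((B a w - B b w) ^+ 2)%:E = (`|a - b| `^ (2 * H))%:E)%E.
Proof. by move=> a0 b0; have := fbm_increments fbmB a0 b0; rewrite unlock. Qed.

Lemma integrable_sqr_increment a b : 0 <= a -> 0 <= b ->
  P.-integrable setT (fun w => ((B a w - B b w) ^+ 2)%:E).
Proof.
move=> a0 b0; apply/integrableP; split.
  by apply/measurable_EFinP; apply: measurable_funX; exact: measurable_funB.
under eq_integral do rewrite gee0_abs ?lee_fin ?sqr_ge0//.
by rewrite fbm_sqr_increment// ltry.
Qed.

(** The given second moments are those of increments, so the product is written as half of (B_a -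
    B_e)^2 + (B_b - B_c)^2 - (B_a - B_c)^2 - (B_b - B_e)^2. *)
Lemma fbm_covariance a b c e (x : R) : 0 <= a -> 0 <= b -> 0 <= c -> 0 <= e ->
  P.-integrable setT (fun w => (x * ((B a w - B b w) * (B c w - B e w)))%:E) /\
  (\int[P]_w (x * ((B a w - B b w) * (B c w - B e w)))%:E = (x * fbm_cov a b c e)%:E)%E.
Proof.
move=> a0 b0 c0 e0.
have E : (fun w => (x * ((B a w - B b w) * (B c w - B e w)))%:E) =
  (fun w => (x / 2)%:E * (((B a w - B e w) ^+ 2)%:E + ((B b w - B c w) ^+ 2)%:E
     - (((B a w - B c w) ^+ 2)%:E + ((B b w - B e w) ^+ 2)%:E)))%E.
  by apply/funext => w; rewrite -!EFinD -EFinM; congr _%:E; field.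
have i1 := integrable_sqr_increment a0 e0.
have i2 := integrable_sqr_increment b0 c0.
have i3 := integrable_sqr_increment a0 c0.
have i4 := integrable_sqr_increment b0 e0.
have i12 := integrableD measurableT i1 i2.
have i34 := integrableD measurableT i3 i4.
have i := integrableB measurableT i12 i34.
rewrite E; split; first exact: integrableZl.
rewrite integralZl// integralB// !integralD// !fbm_sqr_increment// -!EFinD -EFinM.
by congr _%:E; rewrite /fbm_cov; field.
Qed.

Lemma integral_sqr_increments :
  (\int[P]_w (W w ^+ 2)%:E =
   (\sum_(i < k) \sum_(j < k) z i * z j * fbm_cov (t i) (u i) (t j) (u j))%:E)%E.
Proof.
have E w : (W w ^+ 2)%:E = (\sum_(i < k) \sum_(j < k)
    (z i * z j * ((B (t i) w - B (u i) w) * (B (t j) w - B (u j) w)))%:E)%E.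
  rewrite expr2 /W mulr_suml -sumEFin; apply: eq_bigr => i _.
  rewrite mulr_sumr -sumEFin; apply: eq_bigr => j _.
  by congr _%:E; ring.
under eq_integral do rewrite E.
rewrite integral_sum//; last first.
  move=> i; apply: integrable_sum => // j _.
  by have [] := fbm_covariance (z i * z j) (t0 i) (u0 i) (t0 j) (u0 j).
rewrite -sumEFin; apply: eq_bigr => i _.
rewrite integral_sum//; last first.
  by move=> j; have [] := fbm_covariance (z i * z j) (t0 i) (u0 i) (t0 j) (u0 j).
rewrite -sumEFin; apply: eq_bigr => j _.
by have [] := fbm_covariance (z i * z j) (t0 i) (u0 i) (t0 j) (u0 j).
Qed.

Lemma integral_cos_increments :
  (\int[P]_w (cos (W w))%:E =
   (expR (- (\sum_(i < k) \sum_(j < k) z i * z j * fbm_cov (t i) (u i) (t j) (u j)) / 2))%:E)%E.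
Proof.
apply: integral_cos_gaussian.
- exact: measurable_increments.
- exact: increments_gaussian.
- exact: increments_centered.
- exact: integral_sqr_increments.
Qed.

End fbm_increments.

(** * Small-ball estimate *)

Section small_ball.
Context {R : realType}.

(** With truncated subtraction the exponent is |k - l|, so this is a two-sided geometric series,
    bounded uniformly in [k] and [N]. *)
Lemma sum_geometric_dist_le (q : R) (k N : nat) : 0 < q < 1 ->
  \sum_(l < N) q ^+ (k - l + (l - k)) <= 2 / (1 - q).
Proof.
move=> /andP[q0 q1]; have q1' : 0 < 1 - q by rewrite subr_gt0.
(* The sharper bound keeps the exact contribution (q - q^(k+1)) / (1 - q) of the terms l < k, which
   lets the induction on [k] close. *)
suff : \sum_(l < N) q ^+ (k - l + (l - k)) <= (1 + (q - q ^+ k.+1)) / (1 - q).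
  move=> /le_trans; apply; rewrite ler_pM2r ?invr_gt0//.
  have := exprn_ge0 k.+1 (ltW q0); lra.
elim: k N => [|k IH] [|N].
- by rewrite big_ord0 expr1 subrr addr0 mul1r invr_ge0 ltW.
- rewrite expr1 subrr addr0 ler_pdivlMr//.
  under eq_bigr do rewrite sub0n subn0 add0n.
  have := subrX1 q N.+1; have := exprn_ge0 N.+1 (ltW q0).
  set S := \sum_(i < _) _; nra.
- rewrite big_ord0; apply: divr_ge0; last exact: ltW.
  rewrite addr_ge0// subr_ge0.
  by rewrite -[leRHS]expr1 ler_wiXn2l// ltW.
- rewrite big_ord_recl/= subn0 sub0n addn0.
  under eq_bigr do rewrite /bump/= !add1n !subSS.
  apply: le_trans (lerD (lexx _) (IH N)) _.
  by rewrite ler_pdivlMr// mulrDl divfK ?gt_eqF// (exprS q k.+1); lra.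
Qed.

(** The square of an integer distance is at least the distance, which reduces the sum to a geometric
    one of ratio exp(-c). *)
Lemma sum_gaussian_dist_le (c : R) (k N : nat) : 0 < c ->
  \sum_(l < N) expR (- (c * (k%:R - l%:R) ^+ 2)) <= 2 / (1 - expR (- c)).
Proof.
move=> c0; apply: le_trans (sum_geometric_dist_le k N _); last first.
  by rewrite expR_gt0 expR_lt1 oppr_lt0.
apply: ler_sum => l _; rewrite -expRM_natl ler_expR.
rewrite mulrN lerN2 mulrC ler_pM2l//.
have -> : (k%:R - l%:R) ^+ 2 = ((k - l + (l - k)) ^ 2)%:R :> R.
  have [kl|/ltnW lk] := leqP k l.
    by rewrite (eqP (kl : k - l == 0)%N) add0n -sqrrN opprB -natrB// natrX.
  by rewrite (eqP (lk : l - k == 0)%N) addn0 -natrB// natrX.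
by rewrite ler_nat; case: (k - l + (l - k))%N => // n; rewrite -{1}(expn1 n.+1) leq_pexp2l.
Qed.

(** As |2 x| <= 1 <= pi / 2, the number cos(2 x) = 2 cos(x)^2 - 1 is nonnegative. *)
Lemma cos_ge_half (x : R) : `|x| <= 2^-1 -> 2^-1 <= cos x.
Proof.
move=> x1; have pi1 := @pihalf_ge1 R.
have [xl xr] : - 2^-1 <= x /\ x <= 2^-1 by move: x1; rewrite ler_norml => /andP[].
have c0 : 0 <= cos x by apply: cos_ge0_pihalf; lra.
have c2 : 0 <= cos (x *+ 2).
  by rewrite (mulr2n x); apply: cos_ge0_pihalf; lra.
by move: c2; rewrite cos_mulr2n (mulr2n (cos x ^+ 2)); nra.
Qed.

(** The expansion of |sum_x exp(i a_x)|^2 in real form. *)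
Lemma sqr_sum_cos_sin (K : finType) (a : K -> R) :
  (\sum_x cos (a x)) ^+ 2 + (\sum_x sin (a x)) ^+ 2 =
  \sum_x \sum_y cos (a x - a y).
Proof.
rewrite !expr2 !mulr_suml -big_split/=; apply: eq_bigr => x _.
rewrite !mulr_sumr -big_split/=; apply: eq_bigr => y _.
by rewrite cosB.
Qed.

Context {d : measure_display} {T : measurableType d} (P : probability T R).

Lemma integrable_cos (f : T -> R) : measurable_fun setT f ->
  P.-integrable setT (fun w => (cos (f w))%:E).
Proof.
move=> mf; have mc : measurable_fun setT (fun w => cos (f w)).
  by apply: measurableT_comp mf; exact: continuous_measurable_fun (@continuous_cos R).
apply: (le_integrable _ _ _ (finite_measure_integrable_cst P 1 measurableT)) => //.
  exact/measurable_EFinP.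
by move=> w _; rewrite /= lee_fin normr1 norm_cos_le1.
Qed.

Variables (m : nat) (X : 'I_m -> T -> R) (c : R).
Hypothesis mX : forall j, measurable_fun setT (X j).
Hypothesis c0 : 0 < c.
Hypothesis cfX : forall z : 'I_m -> R,
  (\int[P]_w (cos (\sum_j z j * X j w))%:E <=
   (expR (- (c * \sum_j z j ^+ 2)))%:E)%E.

(** Let [S] be the squared modulus of the sum of exp(i x . X) over x in {0, ..., N - 1}^m. On the
    event every phase is at most 1/2, so S >= (N^m / 2)^2. The mean of [S] is at most N^m D^m with D
    = 2 / (1 - exp(-c)), and Markov's inequality concludes. *)
Lemma small_ball (N : nat) (e : R) : (0 < N)%N -> m%:R * N%:R * e <= 2^-1 ->
  (P [set w | forall j, (`|X j w| <= e)%R] <=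
   (4 * (2 / (1 - expR (- c)) / N%:R) ^+ m)%:E)%E.
Proof.
move=> N0 mNe; pose K := {ffun 'I_m -> 'I_N}.
pose dot (x : K) w := \sum_j (x j)%:R * X j w.
have mlin (z : 'I_m -> R) : measurable_fun setT (fun w => \sum_j z j * X j w).
  by apply: measurable_sum => j; exact: measurable_funM.
pose S w := (\sum_x cos (dot x w)) ^+ 2 + (\sum_x sin (dot x w)) ^+ 2.
have SE w : (S w)%:E = (\sum_(x : K) \sum_(y : K)
    (cos (\sum_j ((x j)%:R - (y j)%:R) * X j w))%:E)%E.
  rewrite /S sqr_sum_cos_sin -sumEFin; apply: eq_bigr => x _.
  rewrite -sumEFin; apply: eq_bigr => y _; congr (cos _)%:E.
  by rewrite /dot -sumrB; apply: eq_bigr => j _; rewrite mulrBl.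
have ES : (\int[P]_w (S w)%:E <= (N%:R ^+ m * (2 / (1 - expR (- c))) ^+ m)%:E)%E.
  under eq_integral do rewrite SE.
  rewrite integral_sum//; last first.
    by move=> x; apply: integrable_sum => // y _; exact: integrable_cos.
  have -> : N%:R ^+ m * (2 / (1 - expR (- c))) ^+ m =
      \sum_(x : K) (2 / (1 - expR (- c))) ^+ m.
    by rewrite sumr_const card_ffun !card_ord -[RHS]mulr_natl natrX.
  rewrite -sumEFin; apply: lee_sum => x _.
  rewrite integral_sum//; last by move=> y; exact: integrable_cos.
  apply: (@le_trans _ _ (\sum_(y : K) \prod_j
      expR (- (c * ((x j)%:R - (y j)%:R) ^+ 2)))%:E).
    rewrite -sumEFin; apply: lee_sum => y _.
    apply: le_trans (cfX _) _.
    by rewrite lee_fin -expR_sum ler_expR sumrN mulr_sumr.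
  (* The sum over the box of a product over coordinates factorises into one-dimensional Gaussian
     sums. *)
  rewrite lee_fin -(bigA_distr_bigA
    (fun (j : 'I_m) (l : 'I_N) => expR (- (c * ((x j)%:R - l%:R) ^+ 2)))).
  rewrite -[X in _ ^+ X]card_ord -prodr_const.
  apply: ler_prod => j _; rewrite sumr_ge0/= => [|l _]; last exact: expR_ge0.
  exact: sum_gaussian_dist_le.
set A := [set w | _].
have mA : measurable A.
  have -> : A = \bigcap_(j in [set: 'I_m]) [set w | `|X j w| <= e].
    by apply/seteqP; split=> w h j; [move=> _; exact: h|exact: h].
  apply: fin_bigcap_measurable => // j _.
  exact: measurable_norm_le.
have SA w : A w -> (N%:R ^+ m / 2) ^+ 2 <= S w.
  move=> Aw; rewrite /S -[leLHS]addr0; apply: lerD; last exact: sqr_ge0.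
  suff h : N%:R ^+ m / 2 <= \sum_x cos (dot x w).
    by rewrite ler_sqr// nnegrE ?(le_trans _ h)// divr_ge0// exprn_ge0.
  have -> : N%:R ^+ m / 2 = \sum_(x : K) 2^-1 :> R.
    by rewrite sumr_const card_ffun !card_ord -[RHS]mulr_natl natrX.
  apply: ler_sum => x _; apply: cos_ge_half; apply: le_trans mNe.
  rewrite /dot; apply: le_trans (ler_norm_sum _ _ _) _.
  have -> : m%:R * N%:R * e = \sum_(j < m) N%:R * e.
    by rewrite sumr_const card_ord -[RHS]mulr_natl mulrA.
  apply: ler_sum => j _.
  rewrite normrM normr_nat; apply: ler_pM => //.
  by rewrite ler_nat ltnW.
have mS : measurable_fun setT (fun w => (S w)%:E).
  under eq_fun do rewrite SE.
  apply: emeasurable_sum => x; apply: emeasurable_sum => y.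
  apply/measurable_EFinP; apply: measurableT_comp (mlin _).
  exact: continuous_measurable_fun (@continuous_cos R).
have m1 : measurable_fun setT (fun w => (\1_A w)%:E : \bar R).
  by apply/measurable_EFinP; exact: measurable_indic.
have : (((N%:R ^+ m / 2) ^+ 2)%:E * P A <=
    (N%:R ^+ m * (2 / (1 - expR (- c))) ^+ m)%:E)%E.
  apply: le_trans ES.
  rewrite -(setIT A) -integral_indic// -ge0_integralZl//=.
  apply: ge0_le_integral => //=.
  - exact: emeasurable_funM.
  - move=> w _; rewrite -EFinM lee_fin indicE; case: (boolP (w \in A)) => [|_].
      by rewrite inE mulr1 => /SA.
    by rewrite mulr0 addr_ge0// sqr_ge0.
have Nm : 0 < N%:R ^+ m :> R by rewrite exprn_gt0// ltr0n.
rewrite -lee_pdivlMl ?exprn_gt0 ?divr_gt0// => /le_trans; apply.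
rewrite -EFinM lee_fin; move: (2 / (1 - _)) => D.
rewrite !expr_div_n le_eqVlt; apply/orP; left; apply/eqP.
by field; rewrite gt_eqF.
Qed.

End small_ball.

(** * Almost uncorrelated increments *)

Section second_difference.
Context {R : realType}.

Lemma continuous_within_is_derive (f df : R -> R) (a b : R) :
  (forall x, a <= x <= b -> is_derive x (1 : R) f (df x)) ->
  {within `[a, b], continuous f}.
Proof.
move=> dF; apply: derivable_within_continuous => x; rewrite in_itv/= => /dF dx.
exact: ex_derive.
Qed.

Lemma is_derive_powR_sub1 (p x : R) : 1 < x ->
  is_derive x (1 : R) (fun y => (y - 1) `^ p) (p * (x - 1) `^ (p - 1)).
Proof.
move=> x1; have h : 0 < x - 1 by rewrite subr_gt0.
have := is_derive1_powR p h => dp.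
have ds : is_derive x (1 : R) (fun y => y - 1) 1.
  by apply: is_derive_eq; rewrite subr0.
have := @is_derive1_comp R (@powR R ^~ p) (fun y => y - 1) x _ _ dp ds.
by rewrite mulr1.
Qed.

(** The mean value theorem is applied twice: to z^a - (z - 1)^a on [x, x + 1], then to z^(a - 1) on
    [y - 1, y]. The condition on [x] keeps all arguments away from the singularity at 0. *)
Lemma second_difference_powR (a x : R) : 2 < x ->
  exists2 y, x - 1 < y &
    (x + 1) `^ a + (x - 1) `^ a - 2 * x `^ a = a * (a - 1) * y `^ (a - 2).
Proof.
move=> x2.
have d1 (p y : R) : 1 < y -> is_derive y (1 : R) (fun z => z `^ p - (z - 1) `^ p)
    (p * (y `^ (p - 1) - (y - 1) `^ (p - 1))).
  move=> y1; have y0 : 0 < y by rewrite (lt_trans _ y1).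
  have := is_derive1_powR p y0 => dy; have := is_derive_powR_sub1 p y1 => dy1.
  by apply: is_derive_eq; rewrite mulrBr.
have [|||y yx Ey] := @MVT R (fun z => z `^ a - (z - 1) `^ a)
    (fun y => a * (y `^ (a - 1) - (y - 1) `^ (a - 1))) x (x + 1).
- by rewrite ltrDl.
- by move=> z /[!in_itv]/= /andP[xz _]; apply: d1; lra.
- by apply: continuous_within_is_derive => z /andP[xz _]; apply: d1; lra.
have [xy yx1] : x < y /\ y < x + 1 by move: yx; rewrite in_itv/= => /andP[].
have [|||t ty Et] := @MVT R (fun z => z `^ (a - 1))
    (fun y => (a - 1) * y `^ (a - 1 - 1)) (y - 1) y.
- by rewrite ltrBlDr ltrDl.
- by move=> z /[!in_itv]/= /andP[yz _]; apply: is_derive1_powR; lra.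
- by apply: continuous_within_is_derive => z /andP[yz _]; apply: is_derive1_powR; lra.
exists t; first by move: ty; rewrite in_itv/= => /andP[]; lra.
move: Ey; rewrite addrK (_ : x + 1 - x = 1) ?mulr1; last by ring.
rewrite Et (_ : y - (y - 1) = 1) ?mulr1; last by ring.
rewrite (_ : a - 1 - 1 = a - 2); last by ring.
by move=> E; rewrite -mulrA -E; ring.
Qed.

Lemma second_difference_powR_small (a e : R) : 0 < a < 2 -> 0 < e ->
  exists L : nat, forall n : nat, (L <= n)%N ->
    `|(n%:R + 1) `^ a + (n%:R - 1) `^ a - 2 * n%:R `^ a| <= e.
Proof.
move=> /andP[a0 a2] e0.
(* [M] solves M^(a - 2) = e / 4; the 4 absorbs the factor |a (a - 1)|. *)
pose M := (e / 4) `^ (- (2 - a)^-1).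
have M0 : 0 < M by rewrite powR_gt0// divr_gt0.
exists (Num.bound M + 3)%N => n Ln.
have nM : M + 3 <= n%:R.
  have := archi_boundP (ltW M0); move: Ln; rewrite -(ler_nat R) natrD; lra.
have [|y ny ->] := @second_difference_powR a n%:R; first lra.
have y0 : 0 < y by lra.
have ye : y `^ (a - 2) <= e / 4.
  have -> : e / 4 = M `^ (a - 2).
    rewrite /M -powRrM (_ : - (2 - a)^-1 * (a - 2) = 1); first by rewrite powRr1//; lra.
    by field; lra.
  rewrite -(opprB 2 a) !powRN lef_pV2 ?posrE ?(powR_gt0 _ y0) ?(powR_gt0 _ M0)//.
  by rewrite ge0_ler_powR// ?nnegrE; lra.
have aa : `|a * (a - 1)| <= 4 by rewrite ler_norml; nra.
rewrite normrM (ger0_norm (powR_ge0 _ _)).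
apply: le_trans (ler_pM _ _ aa ye) _ => //; first exact: powR_ge0.
by rewrite mulrC divfK.
Qed.

(** By 2 |z_i z_j| <= z_i^2 + z_j^2 the off-diagonal part is at most k e times the sum of squares,
    hence at most half of the diagonal part. *)
Lemma diagonally_dominant_form (k : nat) (c : 'I_k -> 'I_k -> R) (z : 'I_k -> R) (e : R) :
  0 <= e -> k%:R * e <= 2^-1 -> (forall i, c i i = 1) ->
  (forall i j, i != j -> `|c i j| <= e) ->
  2^-1 * \sum_(i < k) z i ^+ 2 <= \sum_(i < k) \sum_(j < k) z i * z j * c i j.
Proof.
move=> e0 ke cii cij.
have h i j : (if i == j then z i ^+ 2 else 0) - e / 2 * z i ^+ 2 - e / 2 * z j ^+ 2
    <= z i * z j * c i j.
  have [->|ij] := eqVneq i j.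
    by rewrite cii mulr1 -expr2; have := sqr_ge0 (z j); nra.
  have := cij _ _ ij; rewrite sub0r => cle.
  suff : `|z i * z j * c i j| <= e / 2 * z i ^+ 2 + e / 2 * z j ^+ 2.
    by rewrite ler_norml => /andP[+ _]; lra.
  rewrite !normrM; apply: (@le_trans _ _ (`|z i| * `|z j| * e)).
    by rewrite ler_wpM2l// mulr_ge0.
  rewrite -(real_normK (num_real (z i))) -(real_normK (num_real (z j))).
  by have := sqr_ge0 (`|z i| - `|z j|); nra.
apply: le_trans (ler_sum _ (fun i _ => ler_sum _ (fun j _ => h i j))).
set S := \sum_(i < k) z i ^+ 2.
have E i : \sum_(j < k) ((if i == j then z i ^+ 2 else 0) - e / 2 * z i ^+ 2
    - e / 2 * z j ^+ 2) = z i ^+ 2 - k%:R * (e / 2) * z i ^+ 2 - e / 2 * S.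
  rewrite !sumrB sumr_const card_ord -mulr_sumr -/S -[X in _ - X - _]mulr_natl.
  rewrite -big_mkcond/= (big_pred1 i) => [|j]; last by rewrite eq_sym.
  by ring.
under eq_bigr do rewrite E.
rewrite !sumrB sumr_const card_ord -mulr_sumr -/S -[X in _ - _ - X]mulr_natl.
have S0 : 0 <= S by apply: sumr_ge0 => i _; exact: sqr_ge0.
by have := @ler_wpM2r _ S S0 _ _ ke; lra.
Qed.

End second_difference.

(** * Small balls for widely spaced increments *)

Section fbm_lag.
Context {d : measure_display} {T : measurableType d} {R : realType}.
Variables (P : probability T R) (H : R) (B : R -> {RV P >-> R}).
Hypothesis H01 : 0 < H < 1.
Hypothesis fbmB : fractional_brownian_motion H B.

(** The correlation of the unit-step increments starting at [p] and [q]: half a second difference of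
    |x|^(2 H) at p - q. *)
Let r (p q : nat) : R := 2^-1 * (`|p%:R + 1 - q%:R| `^ (2 * H) +
  `|p%:R - q%:R - 1| `^ (2 * H) - 2 * `|p%:R - q%:R| `^ (2 * H)).

Let H20 : 2 * H != 0. Proof. by case/andP: H01 => h _; lra. Qed.

Lemma fbm_cov_lattice (h : R) (p q : nat) : 0 < h ->
  fbm_cov H ((p%:R + 1) * h) (p%:R * h) ((q%:R + 1) * h) (q%:R * h) =
  h `^ (2 * H) * r p q.
Proof.
move=> h0; have E (x : R) : `|x * h| `^ (2 * H) = h `^ (2 * H) * `|x| `^ (2 * H).
  by rewrite normrM (gtr0_norm h0) powRM// ?ltW// mulrC.
rewrite /fbm_cov -!mulrBl !E /r.
rewrite (_ : p%:R + 1 - (q%:R + 1) = p%:R - q%:R); last by ring.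
rewrite (_ : p%:R - (q%:R + 1) = p%:R - q%:R - 1); last by ring.
by field.
Qed.

Let rpp p : r p p = 1.
Proof.
rewrite /r (_ : p%:R + 1 - p%:R = 1); last by ring.
rewrite subrr sub0r normrN normr1 normr0 powR1 powR0//.
by field.
Qed.

Let r_small (e : R) : 0 < e -> exists2 L : nat, (0 < L)%N &
  forall p q : nat, (p + L <= q \/ q + L <= p)%N -> `|r p q| <= e.
Proof.
move=> e0; have a2 : 0 < 2 * H < 2 by case/andP: H01 => h1 h2; lra.
have [L hL] := second_difference_powR_small a2 e0.
(* The successor makes the lag n at least 1, so that |n - 1| is n - 1. *)
exists L.+1 => // p q.
suff S (n : nat) : (L < n)%N -> `|2^-1 * ((n%:R + 1) `^ (2 * H) +
    (n%:R - 1) `^ (2 * H) - 2 * n%:R `^ (2 * H))| <= e.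
  case=> h.
    have [n qE] : exists n, q = (p + n)%N by exists (q - p)%N; lia.
    have := S n; have nL : (L < n)%N by lia.
    have n1 : 1 <= n%:R :> R by rewrite ler1n; lia.
    have [b1 b2 b3] : [/\ `|n%:R + 1| = n%:R + 1 :> R, `|n%:R - 1| = n%:R - 1 :> R &
      `|n%:R| = n%:R :> R] by split; rewrite ger0_norm//; lra.
    move=> /(_ nL); congr (`|_ * _| <= _); rewrite /r qE natrD.
    rewrite (_ : p%:R + 1 - (p%:R + n%:R) = - (n%:R - 1)); last by ring.
    rewrite (_ : p%:R - (p%:R + n%:R) - 1 = - (n%:R + 1)); last by ring.
    rewrite (_ : p%:R - (p%:R + n%:R) = - n%:R); last by ring.
    by rewrite !normrN b1 b2 b3; ring.
  have [n pE] : exists n, p = (q + n)%N by exists (p - q)%N; lia.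
  have := S n; have nL : (L < n)%N by lia.
  have n1 : 1 <= n%:R :> R by rewrite ler1n; lia.
  have [b1 b2 b3] : [/\ `|n%:R + 1| = n%:R + 1 :> R, `|n%:R - 1| = n%:R - 1 :> R &
    `|n%:R| = n%:R :> R] by split; rewrite ger0_norm//; lra.
  move=> /(_ nL); congr (`|_ * _| <= _); rewrite /r pE natrD.
  rewrite (_ : q%:R + n%:R + 1 - q%:R = n%:R + 1); last by ring.
  rewrite (_ : q%:R + n%:R - q%:R = n%:R); last by ring.
  by rewrite b1 b2 b3.
move=> Ln; apply: le_trans (hL n (ltnW Ln)).
rewrite normrM (ger0_norm (_ : 0 <= 2^-1)) ?invr_ge0//.
by rewrite ler_piMl// invf_le1// ler1n.
Qed.

(** With starting points [L] steps apart the rescaled increments are almost orthonormal, whatever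
    [h] and [i]; [L] and [K] are therefore uniform in the scale and the position. *)
Lemma fbm_lag_small_ball (m : nat) : (0 < m)%N ->
  exists L : nat, exists2 K : R, 0 <= K & forall (h e : R) (i N : nat),
    0 < h -> (0 < N)%N -> m%:R * N%:R * e <= 2^-1 ->
    (P [set w | forall j : 'I_m,
       (`|B (((i + L * j)%:R + 1) * h) w - B ((i + L * j)%:R * h) w|
          <= h `^ H * e)%R] <= (K / N%:R ^+ m)%:E)%E.
Proof.
(* A correlation of at most 1 / (2 m) is what diagonal dominance requires of an m by m matrix. *)
move=> m0; have e0 : 0 < (2 * m%:R)^-1 :> R by rewrite invr_gt0 mulr_gt0// ltr0n.
have [L L0 hL] := r_small e0.
(* The rate 1/4 combines the 1/2 of diagonal dominance with the 1/2 in exp(- v / 2). *)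
pose D : R := 2 / (1 - expR (- 4^-1)).
have D0 : 0 <= D.
  by rewrite divr_ge0// subr_ge0 ltW// expR_lt1 oppr_lt0 invr_gt0.
exists L, (4 * D ^+ m); first by rewrite mulr_ge0// exprn_ge0.
move=> h e i N h0 N0 mNe.
pose p (j : 'I_m) := (i + L * j)%N.
(* Multiplication by [g] gives every increment of step [h] variance 1. *)
pose g := h `^ (- H).
have g0 : 0 < g by rewrite powR_gt0.
have gg : g * g * h `^ (2 * H) = 1.
  rewrite /g -!powRD; last 2 first.
  - by rewrite (gt_eqF h0) implybT.
  - by rewrite (gt_eqF h0) implybT.
  by rewrite (_ : - H - H + 2 * H = 0) ?powRr0//; ring.
have gh : g * h `^ H = 1.
  by rewrite /g powRN mulVf// gt_eqF// powR_gt0.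
pose X (j : 'I_m) w := g * (B (((p j)%:R + 1) * h) w - B ((p j)%:R * h) w).
have mX j : measurable_fun setT (X j).
  by apply: measurable_funM => //; exact: measurable_funB.
have p0 (j : 'I_m) : 0 <= (p j)%:R * h by rewrite mulr_ge0// ltW.
have p1 (j : 'I_m) : 0 <= ((p j)%:R + 1) * h by rewrite mulr_ge0// ?addr_ge0// ltW.
have cfX (z : 'I_m -> R) :
  (\int[P]_w (cos (\sum_j z j * X j w))%:E <=
   (expR (- (4^-1 * \sum_j z j ^+ 2)))%:E)%E.
  have -> : (\int[P]_w (cos (\sum_j z j * X j w))%:E =
      \int[P]_w (cos (\sum_j (z j * g) *
        (B (((p j)%:R + 1) * h) w - B ((p j)%:R * h) w)))%:E)%E.
    apply: eq_integral => w _; congr (cos _)%:E; apply: eq_bigr => j _.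
    by rewrite /X mulrA.
  rewrite (integral_cos_increments fbmB (fun j => z j * g) p1 p0).
  rewrite lee_fin ler_expR mulNr lerN2 mulrC.
  have -> : \sum_(i0 < m) \sum_(j < m) z i0 * g * (z j * g) *
      fbm_cov H (((p i0)%:R + 1) * h) ((p i0)%:R * h) (((p j)%:R + 1) * h) ((p j)%:R * h) =
      \sum_(i0 < m) \sum_(j < m) z i0 * z j * r (p i0) (p j).
    apply: eq_bigr => k _; apply: eq_bigr => j _.
    rewrite fbm_cov_lattice// -[RHS]mul1r -[X in _ = X * _]gg; ring.
  have := @diagonally_dominant_form R m (fun k j => r (p k) (p j)) z _ (ltW e0).
  set S := \sum_(_ < _) _ ^+ 2; move=> /(_ _ _ _) hS.
  suff : 2^-1 * S <= \sum_(i0 < m) \sum_(j < m) z i0 * z j * r (p i0) (p j) by lra.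
  apply: hS => [|k|k j kj]; last 2 first.
  - exact: rpp.
  - apply: hL; rewrite /p.
    have : (k < j)%N \/ (j < k)%N by apply/orP; rewrite -neq_ltn.
    by move=> [kj'|kj']; [left|right]; nia.
  by rewrite invfM mulrCA divff ?mulr1// pnatr_eq0 -lt0n.
have := @small_ball R _ _ P m X 4^-1 mX _ cfX N e N0 mNe.
rewrite invr_gt0 ltr0n => /(_ isT).
rewrite expr_div_n -/D mulrA; apply: le_trans.
rewrite le_eqVlt; apply/orP; left; apply/eqP; congr (P _).
apply/seteqP; split=> w /= hw j; have := hw j.
  rewrite -(ler_pM2l g0) mulrA gh mul1r; apply: le_trans.
  by rewrite /X normrM (gtr0_norm g0).
rewrite /X normrM (gtr0_norm g0) => hw'.
by rewrite -(ler_pM2l g0) mulrA gh mul1r.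
Qed.

End fbm_lag.

(** * Absence of flat lattice points at arbitrarily fine scales *)

Section fbm_oscillation.
Context {d : measure_display} {T : measurableType d} {R : realType}.
Variables (P : probability T R) (H : R) (B : R -> {RV P >-> R}).
Hypothesis H01 : 0 < H < 1.
Hypothesis fbmB : fractional_brownian_motion H B.

(* The scale is [h = (c N) ^ (- q)], so that an increment of size
   [O (h ^ (H + 1 / q))] is one of size [O (h ^ H / N)]. *)
Definition flat_at (q L c N i : nat) (w : T) : Prop :=
  let h : R := ((c * N) ^ q)%:R^-1 in
  forall j : 'I_q.+1,
    `|B (((i + L * j)%:R + 1) * h) w - B ((i + L * j)%:R * h) w|
    <= h `^ H * (2 * q.+1%:R * N%:R)^-1.

Lemma measurable_flat_at q L c N i : measurable [set w | flat_at q L c N i w].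
Proof.
rewrite /flat_at; set h := _%:R^-1.
rewrite (_ : [set w | _] = \bigcap_(j in [set: 'I_q.+1])
   [set w | `|B (((i + L * j)%:R + 1) * h) w - B ((i + L * j)%:R * h) w|
    <= h `^ H * (2 * q.+1%:R * N%:R)^-1]); last first.
  by apply/seteqP; split=> w hw j; [move=> _; exact: hw|exact: hw].
apply: fin_bigcap_measurable => // j _; apply: measurable_norm_le.
exact: measurable_funB.
Qed.

(** A given point is flat with probability O(N^-(q + 1)), and O(N^q) points are considered, so P(bad
    N) = O(1 / N). The event that all scales beyond [K] are bad is contained in each of these, hence
    null. *)
Lemma fbm_not_flat_ae (q : nat) : exists L : nat, forall c M : nat, (0 < c)%N ->
  {ae P, forall w, forall K : nat, exists2 N : nat, (K < N)%N &
    forall i : nat, (i <= M * (c * N) ^ q)%N -> ~ flat_at q L c N i w}.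
Proof.
have [L [C C0 hL]] := fbm_lag_small_ball H01 fbmB (ltn0Sn q).
exists L => c M c0; apply: ae_foralln => K.
pose bad N := \bigcup_(i < (M * (c * N) ^ q).+1) [set w | flat_at q L c N i w].
have mbad N : measurable (bad N).
  by apply: bigcup_measurable => i _; exact: measurable_flat_at.
pose K' := (M.+1 * c ^ q)%:R * C.
have Pbad N : (0 < N)%N -> (P (bad N) <= (K' / N%:R)%:E)%E.
  move=> N0; rewrite /bad bigcup_mkord.
  apply: le_trans (Boole_inequality _ _) _ => [i _|]; first exact: measurable_flat_at.
  apply: (@le_trans _ _ (\sum_(i < (M * (c * N) ^ q).+1) (C / N%:R ^+ q.+1)%:E)%E).
    apply: lee_sum => i _; apply: hL => //.
      by rewrite invr_gt0 ltr0n expn_gt0 muln_gt0 c0 N0.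
    (* The factor 2 (q + 1) N in [flat_at] makes the small-ball condition an equality. *)
    rewrite le_eqVlt; apply/orP; left; apply/eqP.
    have NN : N%:R != 0 :> R by rewrite pnatr_eq0 -lt0n.
    by field; rewrite NN nat1r pnatr_eq0.
  rewrite sumEFin lee_fin sumr_const card_ord -[leLHS]mulr_natl.
  have NN : 0 < N%:R :> R by rewrite ltr0n.
  have -> : K' / N%:R = (M.+1 * (c * N) ^ q)%:R * (C / N%:R ^+ q.+1).
    rewrite /K' expnMn !natrM !natrX exprS; field.
    by rewrite expf_neq0 gt_eqF.
  apply: ler_wpM2r; first by rewrite divr_ge0// exprn_ge0// ltW.
  by rewrite ler_nat mulSn -add1n leq_add2r expn_gt0 muln_gt0 c0 N0.
exists (\bigcap_(N in [set N | (K < N)%N]) bad N); split.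
- by apply: bigcap_measurable => //; exists K.+1 => /=.
- apply/eqP; rewrite -measure_le0; apply/lee_addgt0Pr => e e0; rewrite add0e.
  have K0 : 0 <= K' by rewrite mulr_ge0.
  (* This scale lies beyond [K] and satisfies K' / N <= e. *)
  pose N := (maxn K (Num.bound (K' / e))).+1.
  apply: le_trans (_ : P (bad N) <= _)%E.
    apply: le_measure; rewrite ?inE//.
      by apply: bigcap_measurable => //; exists K.+1 => /=.
    by move=> w; apply; rewrite /= ltnS leq_maxl.
  apply: le_trans (Pbad _ _) _ => //.
  rewrite lee_fin ler_pdivrMr ?ltr0n// mulrC -ler_pdivrMr//.
  apply: le_trans (ltW (archi_boundP _)) _; first by rewrite divr_ge0// ltW.
  by rewrite ler_nat (leq_trans (leq_maxr K _)).
- move=> w /= hw N /= KN.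
  apply: contrapT => nb; apply: hw; exists N => // i iM fl; apply: nb.
  by exists i.
Qed.

End fbm_oscillation.

(** * Hoelder regularity *)

Section fbm_dyadic.
Context {d : measure_display} {T : measurableType d} {R : realType}.
Variables (P : probability T R) (H : R) (B : R -> {RV P >-> R}).
Hypothesis fbmB : fractional_brownian_motion H B.

Lemma fbm_increment_tail (a b y : R) : 0 <= a -> 0 <= b -> a != b -> 0 <= y ->
  (P [set w | (y <= `|B a w - B b w|)%R] <=
   (Num.sqrt 2 * expR (- (y ^+ 2 / (4 * `|a - b| `^ (2 * H)))))%:E)%E.
Proof.
move=> a0 b0 ab y0.
have E : (fun w => B a w - B b w) = (fun w => \sum_(j < 1) 1 * (B a w - B b w)).
  by apply/funext => w; rewrite big_ord1 mul1r.
apply: (@gaussian_tail_bound _ _ _ P (fun w => B a w - B b w)) => //.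
- exact: measurable_funB.
- by rewrite E; apply: (increments_gaussian fbmB (fun=> 1) (fun=> a0) (fun=> b0)).
- rewrite -[RHS](increments_centered fbmB (k := 1) (fun=> 1) (fun=> a0) (fun=> b0)).
  by apply: eq_integral => w _; rewrite big_ord1 mul1r.
- exact: fbm_sqr_increment.
- by rewrite powR_gt0// normr_gt0 subr_eq0.
Qed.

Lemma powR_exprn (x a : R) (k : nat) : 0 <= x -> (x ^+ k) `^ a = (x `^ a) ^+ k.
Proof.
move=> x0; elim: k => [|k IH]; first by rewrite !expr0 powR1.
by rewrite !exprS powRM ?exprn_ge0// IH.
Qed.

(** The inequality exp(u / p) >= u / p, inverted and raised to the power [p]; it turns Gaussian
    tails into summable geometric ones. *)
Lemma expRN_le_expr (u : R) (p : nat) : (0 < p)%N -> 0 < u ->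
  expR (- u) <= (p%:R / u) ^+ p.
Proof.
move=> p0 u0; have p0' : 0 < p%:R :> R by rewrite ltr0n.
have -> : - u = p%:R * (- (u / p%:R)) by field; exact: lt0r_neq0.
rewrite expRM_natl; apply: lerXn2r.
- by rewrite nnegrE expR_ge0.
- by rewrite nnegrE divr_ge0// ltW.
rewrite expRN -[leRHS]invf_div lef_pV2 ?posrE ?expR_gt0 ?divr_gt0//.
by apply: le_trans (expR_ge1Dx _); rewrite lerDr.
Qed.

(** Borel-Cantelli: at level [k] an increment exceeds the threshold with probability O(4^-k), and
    there are M 2^k of them, so P(bad k) = O(2^-k). *)
Lemma fbm_dyadic_increments_ae (p M : nat) : (0 < p)%N ->
  {ae P, forall w, exists K : nat, forall k i : nat, (K <= k)%N ->
    (i < M * 2 ^ k)%N ->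
    `|B ((i%:R + 1) * 2^-1 ^+ k) w - B (i%:R * 2^-1 ^+ k) w|
      <= (2^-1 `^ (H - p%:R^-1)) ^+ k}.
Proof.
move=> p0; pose c : R := 2^-1 `^ (H - p%:R^-1).
have c0 : 0 < c by rewrite powR_gt0.
have p0' : 0 < p%:R :> R by rewrite ltr0n.
pose Y k i w := B ((i%:R + 1) * 2^-1 ^+ k) w - B (i%:R * 2^-1 ^+ k) w.
pose bad k := \bigcup_(i < M * 2 ^ k) [set w | c ^+ k <= `|Y k i w|].
have mY k i : measurable [set w | c ^+ k <= `|Y k i w|].
  by apply: measurable_norm_ge; exact: measurable_funB.
have mbad k : measurable (bad k) by apply: bigcup_measurable.
pose C : R := M%:R * (Num.sqrt 2 * (4 * p%:R) ^+ p).
have C0 : 0 <= C by rewrite !mulr_ge0// exprn_ge0// mulr_ge0.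
(* b^k, with b = 4^(1/p), is the squared threshold divided by the variance at level [k]; the power
   [p] in [expRN_le_expr] turns it into 4^k. *)
pose b : R := 2^-1 `^ (- (2 / p%:R)).
have bp : b ^+ p = 4.
  rewrite -powR_mulrn ?powR_ge0// -powRrM mulNr divfK ?gt_eqF//.
  by rewrite powR_invn// exprVn invrK; ring.
have b0 : 0 < b by rewrite powR_gt0.
have PY k i : (P [set w | (c ^+ k <= `|Y k i w|)%R] <=
    (Num.sqrt 2 * (4 * p%:R) ^+ p / 4 ^+ k)%:E)%E.
  have k0 : 0 < 2^-1 ^+ k :> R by rewrite exprn_gt0.
  apply: le_trans (fbm_increment_tail _ _ _ _) _.
  - by rewrite mulr_ge0// ?addr_ge0// ltW.
  - by rewrite mulr_ge0// ltW.
  - by rewrite -subr_eq0 -mulrBl addrAC subrr add0r mul1r gt_eqF.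
  - by rewrite exprn_ge0// ltW.
  rewrite -mulrBl addrAC subrr add0r mul1r (gtr0_norm k0) powR_exprn// lee_fin -mulrA.
  apply: ler_wpM2l => //.
  have -> : (c ^+ k) ^+ 2 / (4 * (2^-1 `^ (2 * H)) ^+ k) = b ^+ k / 4.
    have E : c ^+ 2 = b * 2^-1 `^ (2 * H).
      rewrite /b -powRD; last by rewrite invr_neq0 ?implybT.
      rewrite -powR_mulrn ?powR_ge0// -powRrM; congr (_ `^ _).
      by field; exact: lt0r_neq0.
    rewrite -exprM mulnC exprM E exprMn; field.
    by rewrite expf_neq0// gt_eqF// powR_gt0.
  apply: le_trans (expRN_le_expr p0 _) _; first by rewrite divr_gt0// exprn_gt0.
  by rewrite invf_div mulrA expr_div_n -exprM mulnC exprM bp (mulrC 4).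
(* The bound C / 2^k is put in the shape summed by [epsilon_trick0]. *)
have Pbad k : (P (bad k) <= (2 * C / (2 ^ k.+1)%:R)%:E)%E.
  rewrite /bad bigcup_mkord.
  apply: le_trans (Boole_inequality P (A := fun i => [set w | c ^+ k <= `|Y k i w|])
    (fun i _ => mY k i)) _.
  apply: (@le_trans _ _
    (\sum_(i < M * 2 ^ k) (Num.sqrt 2 * (4 * p%:R) ^+ p / 4 ^+ k)%:E)%E).
    by apply: lee_sum => i _; exact: PY.
  rewrite sumEFin lee_fin sumr_const card_ord -[leLHS]mulr_natl natrM !natrX /C.
  rewrite le_eqVlt; apply/orP; left; apply/eqP.
  have -> : 4 ^+ k = 2 ^+ k * 2 ^+ k :> R by rewrite -exprMn; congr (_ ^+ _); ring.
  rewrite exprS; move: (_ ^+ p) => D; field.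
  by rewrite expf_neq0.
have S : (\sum_(n <oo) P (bad n) < +oo)%E.
  apply: le_lt_trans (ltry (2 * C)).
  apply: le_trans (epsilon_trick0 xpredT _); last by rewrite mulr_ge0.
  exact: lee_nneseries.
have := lim_sup_set_cvg0 mbad S => L0.
exists (lim_sup_set bad); split => //.
  by apply: bigcap_measurable => // n _; apply: bigcup_measurable.
move=> w /= hw K _ /=; apply: contrapT => nb; apply: hw; exists K => k i Kk iM.
rewrite leNgt; apply/negP => lt; apply: nb; exists k => //; exists i => //.
exact: ltW.
Qed.

End fbm_dyadic.

Lemma half_expr_lt {R : realType} (r : R) : 0 < r -> exists j : nat, 2^-1 ^+ j < r.
Proof.
move=> r0; exists (Num.bound r^-1); set j := Num.bound _.
rewrite exprVn -[ltRHS]invrK ltf_pV2 ?posrE ?exprn_gt0 ?invr_gt0//.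
apply: lt_trans (archi_boundP _) _; first by rewrite invr_ge0 ltW.
by rewrite -/j -natrX ltr_nat ltn_expl.
Qed.

(** * Chaining along dyadic approximations *)

Section dyadic_chaining.
Context {R : realType}.
Variables (f : R -> R) (c : R) (M K : nat).
Hypothesis cf : {within `[0, +oo[, continuous f}.
Hypothesis c01 : 0 < c < 1.
Hypothesis fc : forall k i : nat, (K <= k)%N -> (i < M * 2 ^ k)%N ->
  `|f ((i%:R + 1) * 2^-1 ^+ k) - f (i%:R * 2^-1 ^+ k)| <= c ^+ k.

Let n (k : nat) (t : R) := Num.truncn (t * 2 ^+ k).
Let D (k : nat) (t : R) : R := (n k t)%:R * 2^-1 ^+ k.

Let nP k t : 0 <= t -> (n k t)%:R <= t * 2 ^+ k < (n k t)%:R + 1.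
Proof.
by move=> t0; rewrite natr1; apply: Num.Theory.truncn_itv; rewrite mulr_ge0// exprn_ge0.
Qed.

Let nM k t : 0 <= t -> t < M%:R -> (n k t < M * 2 ^ k)%N.
Proof.
move=> t0 tM; rewrite -(ltr_nat R) natrM natrX.
have /andP[h _] := nP k t0; apply: le_lt_trans h _.
by rewrite ltr_pM2r// exprn_gt0.
Qed.

Let VK (k : nat) : 2 ^+ k * 2^-1 ^+ k = 1 :> R.
Proof. by rewrite -exprMn divff ?expr1n. Qed.

Let DP k t : 0 <= t -> D k t <= t < D k t + 2^-1 ^+ k.
Proof.
move=> t0; have /andP[h1 h2] := nP k t0.
have e0 : 0 < 2^-1 ^+ k :> R by rewrite exprn_gt0.
have := VK k; rewrite /D; set e := 2^-1 ^+ k in e0 *; set E := 2 ^+ k => Ee.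
apply/andP; split.
  have := ler_wpM2r (ltW e0) h1; rewrite -mulrA Ee mulr1; exact.
have : t * E * e < ((n k t)%:R + 1) * e by rewrite ltr_pM2r.
by rewrite -mulrA Ee mulr1 mulrDl mul1r.
Qed.

(** Passing to level k + 1 turns the index n into 2 n or 2 n + 1, so the two approximations coincide
    or are neighbours on the finer grid. *)
Let D_succ k t : (K <= k)%N -> 0 <= t -> t < M%:R ->
  `|f (D k.+1 t) - f (D k t)| <= c ^+ k.+1.
Proof.
move=> Kk t0 tM; have /andP[c0 _] := c01.
have /andP[h1 h2] := nP k t0; have /andP[g1 g2] := nP k.+1 t0.
have DE : D k t = (2 * n k t)%:R * 2^-1 ^+ k.+1.
  by rewrite /D natrM exprS; field.
have : (n k.+1 t = 2 * n k t)%N \/ (n k.+1 t = (2 * n k t).+1)%N.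
  have l1 : (2 * n k t < (n k.+1 t).+1)%N.
    rewrite -(ltr_nat R) natrM -[ltRHS]natr1; apply: le_lt_trans g2.
    by rewrite exprS; have := h1; lra.
  have l2 : (n k.+1 t < 2 * n k t + 2)%N.
    rewrite -(ltr_nat R) natrD natrM; apply: le_lt_trans g1 _.
    by rewrite exprS; have := h2; lra.
  by move: (n k.+1 t) (n k t) l1 l2 => a b; clear; lia.
move=> [nE|nE].
  by rewrite DE {1}/D nE subrr normr0 exprn_ge0// ltW.
rewrite DE {1}/D nE -natr1; apply: fc; first exact: leqW.
by have := nM k t0 tM; rewrite expnS; move: (n k t) (2 ^ k)%N => a b; clear; nia.
Qed.

(** The telescoped sum of c^l for k < l <= k + j. *)
Let D_chain k j t : (K <= k)%N -> 0 <= t -> t < M%:R ->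
  `|f (D (k + j) t) - f (D k t)| <= c * (c ^+ k - c ^+ (k + j)) / (1 - c).
Proof.
move=> Kk t0 tM; have /andP[c0 c1] := c01.
have c1' : 0 < 1 - c by rewrite subr_gt0.
elim: j => [|j IH]; first by rewrite addn0 !subrr normr0 mulr0 mul0r.
have := D_succ (leq_trans Kk (leq_addr j k)) t0 tM.
rewrite addnS => h; apply: le_trans (ler_distD (f (D (k + j) t)) _ _) _.
apply: le_trans (lerD h IH) _.
rewrite le_eqVlt; apply/orP; left; apply/eqP; rewrite exprS; field.
exact: lt0r_neq0.
Qed.

(** The bound of [D_chain] is uniform in [j], and the approximations converge to [t], where [f] is
    continuous. *)
Let D_limit k t : (K <= k)%N -> 0 <= t -> t < M%:R ->
  `|f t - f (D k t)| <= c ^+ k / (1 - c).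
Proof.
move=> Kk t0 tM; have /andP[c0 c1] := c01.
have c1' : 0 < 1 - c by rewrite subr_gt0.
apply/ler_addgt0Pr => e e0.
have /subspace_continuousP/(_ t) := cf.
rewrite /= in_itv/= t0 => /(_ isT) /cvgrPdist_le /(_ _ e0).
rewrite near_withinE => /nbhs_ballP[r /= r0 hr].
have [j j_r] := half_expr_lt r0.
have jr : 2^-1 ^+ (k + j) < r.
  by apply: le_lt_trans j_r; rewrite ler_wiXn2l ?leq_addl// invf_le1// ler1n.
have /andP[D1 D2] := DP (k + j) t0.
have D0 : 0 <= D (k + j) t by rewrite mulr_ge0// exprn_ge0.
have h1 : `|f t - f (D (k + j) t)| <= e.
  apply: hr; last by rewrite /= in_itv/= D0.
  by rewrite /ball/= ger0_norm ?subr_ge0//; lra.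
have h2 := D_chain j Kk t0 tM.
apply: le_trans (ler_distD (f (D (k + j) t)) _ _) _; rewrite addrC.
apply: lerD => //; apply: le_trans h2 _.
rewrite ler_pM2r ?invr_gt0//.
have := exprn_gt0 k c0; have := exprn_gt0 (k + j) c0; nra.
Qed.

(** At distance at most 2^-k, the approximations of [t] and [u] at level [k] coincide or are
    adjacent; [D_limit] bounds the two remaining pieces. *)
Lemma dyadic_chaining k t u : (K <= k)%N -> 0 <= t -> t < M%:R -> 0 <= u -> u < M%:R ->
  `|t - u| <= 2^-1 ^+ k -> `|f t - f u| <= (2 / (1 - c) + 1) * c ^+ k.
Proof.
move=> Kk; wlog ut : t u / u <= t.
  move=> h t0 tM u0 uM tu; have [ut|/ltW tu'] := leP u t; first exact: h.
  by rewrite distrC; apply: h => //; rewrite distrC.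
move=> t0 tM u0 uM; rewrite ger0_norm ?subr_ge0// => tu.
have /andP[c0 _] := c01.
have h : `|f (D k t) - f (D k u)| <= c ^+ k.
  have /andP[h1 h2] := nP k t0; have /andP[g1 g2] := nP k u0.
  have E0 : 0 < 2 ^+ k :> R by rewrite exprn_gt0.
  have utE : u * 2 ^+ k <= t * 2 ^+ k by rewrite ler_pM2r.
  have tuE : (t - u) * 2 ^+ k <= 1.
    by rewrite -[leRHS](VK k) [leLHS]mulrC ler_pM2l.
  have : (n k t = n k u)%N \/ (n k t = (n k u).+1)%N.
    have l1 : (n k u < (n k t).+1)%N.
      by rewrite -(ltr_nat R) -natr1; apply: le_lt_trans h2; apply: le_trans utE.
    have l2 : (n k t < n k u + 2)%N.
      by rewrite -(ltr_nat R) natrD; lra.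
    by move: (n k t) (n k u) l1 l2 => a b; clear; lia.
  move=> [nE|nE]; first by rewrite /D nE subrr normr0 exprn_ge0// ltW.
  rewrite /D nE -natr1; apply: fc => //; exact: nM.
have ht := D_limit Kk t0 tM; have hu := D_limit Kk u0 uM.
apply: le_trans (ler_distD (f (D k t)) _ _) _.
apply: le_trans (lerD ht (ler_distD (f (D k u)) _ _)) _.
rewrite (distrC _ (f u)).
apply: le_trans (lerD (lexx _) (lerD h hu)) _.
by rewrite mulrDl mul1r mulrAC; lra.
Qed.

End dyadic_chaining.

(** * From dyadic increments to a Hoelder bound *)

Section hoelder_from_dyadic.
Context {R : realType}.

Lemma dyadic_scale (x : R) (K : nat) : 0 < x <= 2^-1 ^+ K ->
  exists2 k : nat, (K <= k)%N & 2^-1 ^+ k.+1 < x <= 2^-1 ^+ k.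
Proof.
move=> /andP[x0 xK].
have [j jx] := half_expr_lt x0.
elim: j jx => [|j IH] jx.
  exists K => //; rewrite xK andbT; apply: le_lt_trans jx.
  by rewrite ler_wiXn2l// invf_le1// ler1n.
have [/IH//|xj] := ltP (2^-1 ^+ j) x.
have [Kj|jK] := leqP K j; first by exists j => //; rewrite jx.
exists K => //; rewrite xK andbT; apply: le_lt_trans jx.
by rewrite ler_wiXn2l// ?invf_le1 ?ler1n// ltnS ltnW.
Qed.

Lemma hoelder_of_dyadic (f : R -> R) (g : R) (M K : nat) : 0 < g ->
  {within `[0, +oo[, continuous f} ->
  (forall k i : nat, (K <= k)%N -> (i < M * 2 ^ k)%N ->
    `|f ((i%:R + 1) * 2^-1 ^+ k) - f (i%:R * 2^-1 ^+ k)| <= (2^-1 `^ g) ^+ k) ->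
  exists2 C : R, 0 <= C & forall t u, 0 <= t -> t < M%:R -> 0 <= u -> u < M%:R ->
    `|t - u| <= 2^-1 ^+ K -> `|f t - f u| <= C * `|t - u| `^ g.
Proof.
move=> g0 cf fc; pose c : R := 2^-1 `^ g.
have c01 : 0 < c < 1.
  have c1 : c < 1 `^ g.
    by apply: gt0_ltr_powR; rewrite ?nnegrE// invf_lt1// ltr1n.
  by rewrite powR_gt0//=; move: c1; rewrite powR1.
have /andP[c0 c1] := c01.
pose C := 2 / (1 - c) + 1.
have C0 : 0 <= C by rewrite addr_ge0// divr_ge0// subr_ge0 ltW.
(* Chaining bounds by C c^k, while |t - u| > 2^-(k + 1) only controls c^(k + 1); the division by [c]
   makes up for the lost level. *)
exists (C / c); first by rewrite divr_ge0// ltW.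
move=> t u t0 tM u0 uM tu.
have [->|neq] := eqVneq t u; first by rewrite subrr normr0 mulr_ge0 ?powR_ge0// divr_ge0// ltW.
have [k Kk /andP[kl ku]] : exists2 k : nat, (K <= k)%N & 2^-1 ^+ k.+1 < `|t - u| <= 2^-1 ^+ k.
  by apply: dyadic_scale; rewrite tu normr_gt0 subr_eq0 neq.
apply: le_trans (dyadic_chaining cf c01 fc Kk t0 tM u0 uM ku) _.
rewrite -/C -mulrA ler_wpM2l// mulrC ler_pdivlMr// mulrC -exprS -powR_exprn//.
by apply: ge0_ler_powR; rewrite ?nnegrE ?exprn_ge0// ltW.
Qed.

End hoelder_from_dyadic.

(** * The frontier *)

Section frontier_value.
Context {R : realType}.
Variables (f : R -> R) (t0 s' : R).
Hypothesis t00 : 0 <= t0.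

Lemma ball_nonnegP (rho t : R) :
  ball_nonneg t0 rho t <-> `|t0 - t| < rho /\ 0 <= t.
Proof. by rewrite /ball_nonneg /= in_itv/= andbT. Qed.

(** With d = |t - u| <= 2 rho and d <= 1, one has d^g <= d^sigma d^(-s') <= d^sigma (2
    rho)^(-s'). *)
Lemma limf_esup_increment_lty (sigma g C dl M : R) :
  s' < 0 -> sigma - s' <= g -> 0 <= C -> 0 < dl -> t0 < M ->
  (forall t u, 0 <= t -> t < M -> 0 <= u -> u < M -> `|t - u| <= dl ->
    `|f t - f u| <= C * `|t - u| `^ g) ->
  (limf_esup (increment_ratio_sup f t0 s' sigma) 0^'+ < +oo)%E.
Proof.
move=> s0 sg C0 dl0 tM hf.
(* The three terms keep both points below [M], their distance below [dl], and their distance below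
   1, so that lowering the exponent increases the power. *)
pose r := Num.min (Num.min (M - t0) (dl / 2)) (2^-1).
have r0 : 0 < r by rewrite !lt_min subr_gt0 tM divr_gt0//= invr_gt0.
rewrite limf_esupE.
apply: (@le_lt_trans _ _ (C * 2 `^ (- s'))%:E); last by rewrite ltry.
apply: ge_ereal_inf.
exists (ereal_sup (increment_ratio_sup f t0 s' sigma @` [set rho | 0 < rho < r])).
  exists [set rho | 0 < rho < r] => //.
  near=> rho => /=; apply/andP; split; near: rho.
    exact: nbhs_right_gt.
  exact: nbhs_right_lt.
apply: ge_ereal_sup => _ [rho /= /andP[rho0 rhor] <-].
apply: ge_ereal_sup => _ [[t u] /= [/ball_nonnegP[tb t0'] /ball_nonnegP[ub u0] tu] <-].
rewrite lee_fin.
move: rhor; rewrite !lt_min => /andP[/andP[rM rdl] r2].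
have [tb1 tb2] : t0 - rho < t /\ t < t0 + rho.
  by move: tb; rewrite ltr_norml => /andP[]; lra.
have [ub1 ub2] : t0 - rho < u /\ u < t0 + rho.
  by move: ub; rewrite ltr_norml => /andP[]; lra.
have tu2 : `|t - u| <= 2 * rho by rewrite ler_norml; lra.
have tu0 : 0 < `|t - u| by rewrite normr_gt0 subr_eq0.
have tun : `|t - u| != 0 by rewrite gt_eqF.
have den : 0 < `|t - u| `^ sigma * rho `^ (- s') by rewrite mulr_gt0// powR_gt0.
rewrite ler_pdivrMr//.
have tuM : `|f t - f u| <= C * `|t - u| `^ g by apply: hf => //; lra.
apply: le_trans tuM _; rewrite -mulrA ler_wpM2l//.
rewrite mulrCA -powRM ?(ltW rho0)//.
apply: (@le_trans _ _ (`|t - u| `^ sigma * `|t - u| `^ (- s'))).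
  rewrite -powRD ?tun ?implybT//.
  by apply: ger_powR => //; rewrite tu0/=; lra.
apply: ler_wpM2l; first exact: powR_ge0.
by apply: ge0_ler_powR; rewrite ?nnegrE; lra.
Unshelve. all: by end_near. Qed.

Lemma limf_esup_increment_bound (sigma : R) :
  (limf_esup (increment_ratio_sup f t0 s' sigma) 0^'+ < +oo)%E ->
  exists C r : R, [/\ 0 <= C, 0 < r & forall rho t u, 0 < rho < r ->
    ball_nonneg t0 rho t -> ball_nonneg t0 rho u -> t != u ->
    `|f t - f u| <= C * (`|t - u| `^ sigma * rho `^ (- s'))].
Proof.
rewrite limf_esupE => /ereal_inf_lt[_ [V V0 <-] supV].
have [r /= r0 rV] : exists2 r, 0 < r & forall rho, 0 < rho < r -> V rho.
  move: V0; rewrite /at_right /within /= => /nbhs_ballP[r /= r0 hr].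
  exists r => // rho /andP[rho0 rhor]; apply: hr => //.
  by rewrite /ball/= sub0r normrN gtr0_norm.
have [C C0 hC] : exists2 C : R, 0 <= C &
    (ereal_sup (increment_ratio_sup f t0 s' sigma @` V) <= C%:E)%E.
  move: supV; case: ereal_sup => [x _|//|_].
    by exists (Num.max 0 x); rewrite ?lee_fin le_max lexx ?orbT.
  by exists 0 => //; exact: leNye.
exists C, r; split=> // rho t u rhor tb ub tu.
have rho0 : 0 < rho by case/andP: rhor.
have tu0 : 0 < `|t - u| by rewrite normr_gt0 subr_eq0.
have den : 0 < `|t - u| `^ sigma * rho `^ (- s') by rewrite mulr_gt0// powR_gt0.
rewrite -ler_pdivrMr// -lee_fin; apply: le_trans hC.
apply: le_trans (ereal_sup_ubound _); last first.
  by exists rho => //; exact: rV.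
by apply: ereal_sup_ubound; exists (t, u).
Qed.

Variable H : R.

(** The first path hypothesis bounds the frontier below, the second excludes any larger exponent.
    The freedom in [g'] accommodates the exponents H - 1 / p of the dyadic argument. *)
Lemma microlocal_frontierE : s' < 0 -> 
  (forall g : R, g < H -> exists C dl M : R, exists2 g' : R, g <= g' &
     [/\ 0 <= C, 0 < dl, t0 < M &
     forall t u, 0 <= t -> t < M -> 0 <= u -> u < M -> `|t - u| <= dl ->
    `|f t - f u| <= C * `|t - u| `^ g']) ->
  (forall sigma C r : R, H < sigma - s' -> 0 <= C -> 0 < r ->
    exists rho t u : R, [/\ 0 < rho < r, ball_nonneg t0 rho t, ball_nonneg t0 rho u,
      t != u & C * (`|t - u| `^ sigma * rho `^ (- s')) < `|f t - f u| ]) ->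
  microlocal_frontier f t0 s' = (H + s')%:E.
Proof.
move=> s0 hl hu; apply/eqP; rewrite eq_le; apply/andP; split.
  apply: ge_ereal_sup => _ [sigma /= /limf_esup_increment_bound[C [r [C0 r0 hC]]] <-].
  rewrite lee_fin leNgt; apply/negP => Hs.
  have [|rho [t [u [rhor tb ub tu]]]] := hu sigma C r _ C0 r0; first lra.
  by rewrite ltNge hC.
apply/lee_subgt0Pr => e e0.
apply: ereal_sup_ubound; exists (H + s' - e) => //=.
have [|C [dl [M [g' gg' [C0 dl0 tM hf]]]]] := hl (H - e); first lra.
apply: limf_esup_increment_lty hf => //; lra.
Qed.

End frontier_value.

Lemma exists_inv_lt {R : realType} (x : R) : 0 < x ->
  exists2 p : nat, (0 < p)%N & p%:R^-1 < x.
Proof.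
move=> x0; have x0' : 0 < x^-1 by rewrite invr_gt0.
have b := archi_boundP (ltW x0').
have b0 : 0 < (Num.bound x^-1)%:R :> R by exact: lt_trans b.
exists (Num.bound x^-1); first by rewrite -(ltr_nat R).
by rewrite -[ltRHS]invrK ltf_pV2.
Qed.

(** * The almost sure frontier of fractional Brownian motion *)

Section fbm_frontier.
Context {d : measure_display} {T : measurableType d} {R : realType}.
Variables (P : probability T R) (H : R) (B : R -> {RV P >-> R}).
Hypothesis H01 : 0 < H < 1.
Hypothesis fbmB : fractional_brownian_motion H B.

(** With [i] the lattice index just below [t0], some increment of step [h] near [t0] exceeds h^H /
    (2 (q + 1) N). Since h^(1/q) = 1 / (c N), the competing term is at most C A^(-s') h^H / (c N),
    and [c] was chosen large enough to make this smaller. *)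
Lemma not_flat_increment (f : R -> R) (q L c : nat) (M : nat) (t0 s' sigma C r : R) :
  (0 < q)%N -> (0 < c)%N -> 0 <= t0 -> t0 <= M%:R -> 0 <= C -> 0 < r ->
  H + q%:R^-1 <= sigma - s' ->
  2 * q.+1%:R * C * (L * q + 2)%:R `^ (- s') < c%:R ->
  (forall K : nat, exists2 N : nat, (K < N)%N &
    forall i : nat, (i <= M * (c * N) ^ q)%N ->
    exists j : 'I_q.+1,
    ((c * N) ^ q)%:R^-1 `^ H * (2 * q.+1%:R * N%:R)^-1 <
    `|f (((i + L * j)%:R + 1) * ((c * N) ^ q)%:R^-1)
      - f ((i + L * j)%:R * ((c * N) ^ q)%:R^-1)|) ->
  exists rho t u : R, [/\ 0 < rho < r, ball_nonneg t0 rho t, ball_nonneg t0 rho u,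
      t != u & C * (`|t - u| `^ sigma * rho `^ (- s')) < `|f t - f u| ].
Proof.
move=> q0 c0 t00 t0M C0 r0 Hs Ac hf.
(* The farthest endpoint passes [t0] by at most (L q + 1) h; one more step is added because the ball
   is open. *)
pose A : R := (L * q + 2)%:R.
have A0 : 0 < A by rewrite ltr0n addn_gt0 orbT.
(* As h <= 1 / N, a scale with N > A / r gives A h < r. *)
have [N KN hN] := hf (Num.bound (A / r)).
have N0 : (0 < N)%N by apply: leq_ltn_trans KN.
pose n := (c * N)%N; pose h : R := (n ^ q)%:R^-1.
have n0 : (0 < n)%N by rewrite muln_gt0 c0.
have nq0 : 0 < (n ^ q)%:R :> R by rewrite ltr0n expn_gt0 n0.
have h0 : 0 < h by rewrite invr_gt0.
have hn : (n ^ q)%:R * h = 1 by rewrite divff// gt_eqF.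
have h1 : h <= 1 by rewrite invf_le1// ler1n expn_gt0 n0.
pose i := Num.truncn (t0 * (n ^ q)%:R).
have /andP[i1 i2] : i%:R <= t0 * (n ^ q)%:R < i.+1%:R.
  by apply: truncn_itv; rewrite mulr_ge0// ltW.
have ih1 : i%:R * h <= t0.
  by have := ler_wpM2r (ltW h0) i1; rewrite -mulrA hn mulr1.
have ih2 : t0 < (i%:R + 1) * h.
  have : t0 * (n ^ q)%:R * h < i.+1%:R * h by rewrite ltr_pM2r.
  by rewrite -mulrA hn mulr1 -natr1.
have [j hj] : exists j : 'I_q.+1,
    h `^ H * (2 * q.+1%:R * N%:R)^-1 <
    `|f (((i + L * j)%:R + 1) * h) - f ((i + L * j)%:R * h)|.
  apply: hN; rewrite -(ler_nat R); apply: le_trans i1 _.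
  by rewrite natrM ler_wpM2r// ltW.
pose rho := A * h.
have rho0 : 0 < rho by rewrite mulr_gt0.
have rhor : rho < r.
  have Nr : A / r < N%:R.
    apply: lt_trans (archi_boundP _) _; first by rewrite divr_ge0// ltW.
    by rewrite ltr_nat.
  have nN : N%:R <= (n ^ q)%:R :> R.
    rewrite ler_nat; apply: (@leq_trans n); first by rewrite leq_pmull.
    by rewrite -{1}(expn1 n) leq_pexp2l.
  rewrite /rho ltr_pdivrMr// mulrC -ltr_pdivrMr//.
  exact: lt_le_trans nN.
pose p := (i + L * j)%N.
have p1 : i%:R * h <= p%:R * h by rewrite ler_pM2r// ler_nat leq_addr.
have p2 : p%:R * h <= i%:R * h + (L * q)%:R * h.
  by rewrite -mulrDl ler_pM2r// -natrD ler_nat leq_add2l leq_mul2l -ltnS ltn_ord orbT.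
have rhoE : rho = (L * q)%:R * h + 2 * h by rewrite /rho /A natrD mulrDl.
have Lq0 : 0 <= (L * q)%:R * h by rewrite mulr_ge0// ltW.
have i0h : 0 <= i%:R * h by rewrite mulr_ge0// ltW.
have diff : (p%:R + 1) * h - p%:R * h = h by ring.
exists rho, ((p%:R + 1) * h), (p%:R * h); split.
- by rewrite rho0.
- apply/ball_nonnegP; split; last by rewrite mulrDl mul1r; lra.
  by rewrite ltr_norml mulrDl mul1r; move: ih2; rewrite mulrDl mul1r; lra.
- apply/ball_nonnegP; split; last by lra.
  by rewrite ltr_norml; move: ih2; rewrite mulrDl mul1r; lra.
- by rewrite -subr_eq0 diff gt_eqF.
apply: le_lt_trans hj; rewrite diff (gtr0_norm h0) /rho powRM ?(ltW A0) ?(ltW h0)//.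
have hsig : h `^ sigma * h `^ (- s') <= h `^ H * n%:R^-1.
  rewrite -powRD ?(gt_eqF h0) ?implybT//.
  apply: (@le_trans _ _ (h `^ (H + q%:R^-1))).
    by apply: ger_powR => //; rewrite h0.
  rewrite powRD ?(gt_eqF h0) ?implybT// ler_wpM2l ?powR_ge0//.
  rewrite /h natrX -exprVn -powR_mulrn ?invr_ge0// -powRrM mulfV ?powRr1 ?invr_ge0//.
  by rewrite pnatr_eq0 -lt0n.
rewrite (_ : C * _ = C * A `^ (- s') * (h `^ sigma * h `^ (- s'))); last by ring.
have CA0 : 0 <= C * A `^ (- s') by rewrite mulr_ge0// powR_ge0.
apply: le_trans (ler_wpM2l CA0 hsig) _.
rewrite mulrCA ler_wpM2l ?powR_ge0//.
have N0' : 0 < N%:R :> R by rewrite ltr0n.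
have c0' : 0 < c%:R :> R by rewrite ltr0n.
have q1 : 0 < 2 * q.+1%:R :> R by rewrite mulr_gt0// ltr0n.
rewrite /n natrM ler_pdivrMr ?mulr_gt0// invfM mulrACA mulVf ?gt_eqF// mulr1.
by rewrite ler_pdivlMl// mulrA ltW.
Qed.

(** All exceptional events are indexed by natural numbers, so one null set covers them; the rest is
    pathwise and holds for all [t0] and [s'] at once. *)
Lemma fbm_microlocal_frontier_ae :
  {ae P, forall w, forall t0 s' : R, 0 <= t0 -> s' < 0 ->
    microlocal_frontier (fun t => B t w) t0 s' = (H + s')%:E}.
Proof.
have contB := fbm_continuous fbmB.
have dyad : {ae P, forall w, forall p M : nat, (0 < p)%N -> exists K : nat,
    forall k i : nat, (K <= k)%N -> (i < M * 2 ^ k)%N ->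
    `|B ((i%:R + 1) * 2^-1 ^+ k) w - B (i%:R * 2^-1 ^+ k) w|
      <= (2^-1 `^ (H - p%:R^-1)) ^+ k}.
  apply: ae_foralln => p; apply: ae_foralln => M.
  have [p0|p0] := posnP p; first by apply: aeW => w; rewrite p0.
  by apply: filterS (fbm_dyadic_increments_ae fbmB M p0) => w hw _.
(* [L] depends on [q] alone and precedes [c], since [c] is later chosen in terms of [L]. *)
have flat : {ae P, forall w, forall q : nat, exists L : nat, forall c M K : nat, (0 < c)%N ->
    exists2 N : nat, (K < N)%N &
    forall i : nat, (i <= M * (c * N) ^ q)%N -> ~ flat_at H B q L c N i w}.
  apply: ae_foralln => q.
  have [L hL] := fbm_not_flat_ae H01 fbmB q.
  suff : {ae P, forall w, forall c M : nat, (0 < c)%N -> forall K : nat,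
    exists2 N : nat, (K < N)%N &
    forall i : nat, (i <= M * (c * N) ^ q)%N -> ~ flat_at H B q L c N i w}.
    by apply: filterS => w hw; exists L => c M K c0; exact: hw.
  apply: ae_foralln => c; apply: ae_foralln => M.
  have [c0|c0] := posnP c; first by apply: aeW => w; rewrite c0.
  by apply: filterS (hL c M c0) => w hw _.
apply: filterS3 contB dyad flat => w contw dyadw flatw t0 s' t00 s0.
apply: microlocal_frontierE => //.
- move=> g gH.
  have /andP[h0 h1] := H01.
  (* The first term yields H - 1 / p >= g, the second H - 1 / p > 0. *)
  pose x : R := Num.min (H - g) H.
  have x0 : 0 < x by rewrite lt_min subr_gt0 gH.
  have [p p0 px] := exists_inv_lt x0.
  have [K hK] := dyadw p (Num.truncn t0).+1 p0.
  have g'0 : 0 < H - p%:R^-1.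
    by move: px; rewrite lt_min => /andP[_]; rewrite subr_gt0.
  have [C C0 hC] := hoelder_of_dyadic g'0 contw hK.
  exists C, (2^-1 ^+ K), (Num.truncn t0).+1%:R, (H - p%:R^-1).
    by move: px; rewrite lt_min => /andP[]; lra.
  by split=> //; exact: Num.Theory.truncnS_gt.
- move=> sigma C r Hs C0 r0.
  have y0 : 0 < sigma - s' - H by lra.
  have [q q0 px] := exists_inv_lt y0.
  have [L hL] := flatw q.
  (* [Z] is the quantity that [not_flat_increment] requires to be below [c]. *)
  pose Z := 2 * q.+1%:R * C * (L * q + 2)%:R `^ (- s').
  pose c := (Num.bound Z).
  have Zc : Z < c%:R by apply: archi_boundP; rewrite !mulr_ge0// powR_ge0.
  have c0 : (0 < c)%N.
    by rewrite -(ltr_nat R); apply: le_lt_trans Zc; rewrite !mulr_ge0// powR_ge0.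
  apply: (@not_flat_increment _ q L c (Num.truncn t0).+1 t0 s' sigma C r) => //.
  + exact/ltW/Num.Theory.truncnS_gt.
  + lra.
  + move=> K; have [N KN hN] := hL c (Num.truncn t0).+1 K c0; exists N => // i iM.
    apply: contrapT => nj; apply: (hN i iM); rewrite /flat_at /= => j.
    by rewrite leNgt; apply/negP => lt; apply: nj; exists j.
Qed.

End fbm_frontier.

Theorem proposition4p1 (R : realType) (d : measure_display)
    (T : measurableType d) (P : probability T R) (H : R)
    (B : R -> {RV P >-> R}) :
  0 < H < 1 -> fractional_brownian_motion H B ->
  {ae P, forall w, forall t0 : R, 0 <= t0 ->
    frontier_graph (fun t => B t w) t0 `&` frontier_region =
    [set p : R * R | p.2 = H + p.1] `&` frontier_region}.
Proof.
move=> H01 fbmB; apply: filterS (fbm_microlocal_frontier_ae H01 fbmB).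
move=> w hw t0 t00; apply/seteqP; split=> -[s' sigma] /=.
  by move=> [[s0 +] reg]; rewrite hw// => -[E]; split.
by move=> [-> [s1 s0 h1 h2]]; split; split=> //; rewrite hw.
Qed.
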